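(* Let $P$ denote an $S$-subbimodule of a connected strongly graded $S$-ring $T$ such that $P\cap S=0$ and let $A:=T/\langle R_P\rangle$. Assume that $A^1$ is projective as a left $S$-module and fix a projective resolution $(A\otimes V_*,d_* )$ of $S$ as described in the context, with $V_n^i=0$ for $n\ge3$ and $i\le1$. The bimodule $P$ is of PBW-type if and only if $\mathrm H_1({}^1M_* )=0$ and either $c_{V_3}=-1$ or $P$ satisfies the Jacobi conditions $(\mathcal J_n)$ for $1\le n\le c_{V_3}$, where $({}^1M_*,\delta_* )$ is the complex corresponding to the central extension $D:=T[z]/\langle P^*\rangle$.
   Context: $S$ is an associative unital ring, $\otimes=\otimes_S$. A positively graded $S$-ring $T=\bigoplus_{n\ge0}T^n$ is connected if $T^0=S$ and strongly graded if $T^nT^m=T^{n+m}$. $p^n:T\to T^n$ is the projection, $T^{\le n}=\bigoplus_{m\le n}T^m$, $X^{\le n}=X\cap T^{\le n}$, $\langle X\rangle$ the two-sided ideal generated by $X$. Shift: $X(d)^n=X^{n+d}$. $R_P:=\bigoplus_nR_P^n$ with $R_P^n:=p^n(P^{\le n})$. $U(P):=T/\langle P\rangle$, filtered by the images of $T^{\le n}$. $P$ is of PBW-type if the surjective graded $S$-ring map $\Phi_P:T/\langle R_P\rangle\to\operatorname{gr}U(P)$, $x+\langle R_P\rangle\mapsto(x+\langle P\rangle)+U(P)^{\le n-1}$ ($x\in T^n$), is an isomorphism. Jacobi condition $(\mathcal J_n)$: $P_{n+1}\cap T^{\le n}\subseteq P_n$, where $P_n:=\sum_{i+j+k=n}T^{\le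 i}P^{\le j}T^{\le k}$. Central extension: $z$ is a central variable of degree $1$; for $a=\sum_{i\le d}a_i\in T$ with $a_i\in T^i$, $a_d\neq0$, $a^*=\sum_ia_iz^{d-i}$ ($0^*=0$); $P^*=\{x^*\mid x\in P\}$. $D=T[z]/\langle P^*\rangle$ is a connected strongly graded $S$-ring, $z$ is central in $D^1$, and $D/zD\cong A$ (setting $z=0$); let $\pi:D\to A$ be the projection. Complexity: $c_V=-1$ if $V=0$, otherwise $c_V=\sup\{n-1\mid V^n\neq0\}$ (if $c_{V_3}=\infty$, all $(\mathcal J_n)$, $n\ge1$, are required). Resolution: a projective resolution of the left $A$-module $S$ $$\cdots\to A\otimes V_n\xrightarrow{d_n}\cdots\to A\otimes V_2\xrightarrow{d_2}A\otimes A^1\xrightarrow{d_1}A\xrightarrow{d_0}S\to0$$ with $V_n$ graded projective left $S$-modules, $d_n$ graded $A$-linear, $d_0$ the projection onto $A^0=S$, $d_1$ induced by multiplication. Complex ${}^1M_*$: put $V_0=S$, $V_1=A^1$, $N_n:=D\otimes V_n$. Choose $\partial_1:N_1\to N_0=D$, $\partial_1(x\otimes a)=x\sigma^1(a)$ with $\sigma^1:A^1\to D^1$ a left $S$-linear section of $\pi^1$; a graded $D$-linear $\partial_2:N_2\to N_1$ with $(\pi\otimes V_1)\partial_2=d_2(\pi\otimes V_2)$; and a graded $D$-linear $f_2:N_2\to N_0(-1)$ with $\partial_1\partial_2=-z\cdot f_2$. Then ${}^1M_*$ is $M_2\xrightarrow{\delta_2}M_1\xrightarrow{\delta_1}M_0\to0$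 with $M_0=D$, $M_1=N_1\oplus N_0(-1)$, $M_2=N_2\oplus N_1(-1)$, $\delta_1(x,y)=\partial_1(x)+zy$, $\delta_2(x,y)=(\partial_2(x)-zy,\ \partial_1(y)+f_2(x))$; $\mathrm H_1({}^1M_* )=\ker\delta_1/\operatorname{im}\delta_2$. *)

(* Defs.v *)
From HB Require Import structures.
From mathcomp Require Import all_boot all_order all_algebra.
From mathcomp Require Import boolp classical_sets functions constructive_ereal.
From mathcomp.multinomials Require Import freeg.

Set Implicit Arguments.
Unset Strict Implicit.
Unset Printing Implicit Defensive.

Import Order.TTheory GRing.Theory Num.Theory.

Local Open Scope classical_set_scope.
Local Open Scope quotient_scope.
Local Open Scope ring_scope.

Definition subgrp (M : zmodType) (X : set M) : Prop :=
  X 0 /\ forall x y, X x -> X y -> X (x - y).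

Definition zspan (M : zmodType) (X : set M) : set M := smallest (@subgrp M) X.

Lemma zspan_subgrp (M : zmodType) (X : set M) : subgrp (zspan X).
Proof.
split=> [Y [[Y0 _] _]|x y Xx Xy Y HY]; first exact: Y0.
by have [[_ YB] _] := HY; apply: YB; [apply: Xx | apply: Xy].
Qed.

Lemma zspan_id (M : zmodType) (X : set M) : subgrp X -> zspan X = X.
Proof. exact: smallest_id. Qed.

Section SubgrpTheory.
Variables (M : zmodType) (X : set M).
Hypothesis HX : subgrp X.

Lemma subgrpN x : X x -> X (- x).
Proof. by move=> Xx; rewrite -[- x]add0r; apply: HX.2 => //; apply: HX.1. Qed.

Lemma subgrpD x y : X x -> X y -> X (x + y).
Proof. by move=> Xx Xy; rewrite -[y]opprK; apply: HX.2 => //; apply: subgrpN. Qed.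

Lemma subgrp_sum (I : Type) (r : seq I) (Q : pred I) (F : I -> M) :
  (forall i, Q i -> X (F i)) -> X (\sum_(i <- r | Q i) F i).
Proof. by move=> XF; apply: big_ind => //; [exact: HX.1 | exact: subgrpD]. Qed.
End SubgrpTheory.

Section ZQuot.
Variables (M : zmodType) (X : set M).

Definition zspanb : {pred M} := fun x => `[< zspan X x >].

Lemma zspanb_closed : zmod_closed zspanb.
Proof.
have [X0 XB] := zspan_subgrp X; split=> [|x y]; first exact/asboolP.
by move=> /asboolP Xx /asboolP Xy; apply/asboolP; apply: XB.
Qed.

HB.instance Definition _ := GRing.isZmodClosed.Build M zspanb zspanb_closed.

Definition zquot : Type := Quotient.quot zspanb.
HB.instance Definition _ := GRing.Zmodule.on zquot.

Definition zpi (x : M) : zquot := \pi_(Quotient.quot zspanb) x.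
Definition zrepr (u : zquot) : M := repr (u : Quotient.quot zspanb).

Lemma zreprK u : zpi (zrepr u) = u.
Proof. exact: reprK. Qed.

Lemma zpi_is_zmod_morphism : zmod_morphism zpi.
Proof. by move=> x y; rewrite /zpi raddfB. Qed.
HB.instance Definition _ :=
  GRing.isZmodMorphism.Build M zquot zpi zpi_is_zmod_morphism.

Lemma zpi_eq x y : zpi x = zpi y <-> zspan X (x - y).
Proof.
have := Quotient.idealrBE zspanb x y; rewrite unfold_in => E.
split=> [/eqP e|/asboolP]; last by rewrite E => /eqP.
by apply/asboolP; rewrite E.
Qed.

Lemma zpi_eq0 x : zpi x = 0 <-> zspan X x.
Proof. by rewrite -(raddf0 zpi) zpi_eq subr0. Qed.

Lemma zpi_surj u : exists x, zpi x = u.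
Proof. by exists (zrepr u); apply: zreprK. Qed.

Lemma zrepr_lift (N : zmodType) (f : M -> N) :
  zmod_morphism f -> (forall x, X x -> f x = 0) ->
  forall x, f (zrepr (zpi x)) = f x.
Proof.
move=> fB fX x; have f0 : f 0 = 0 by rewrite -[X in f X](subrr 0) fB subrr.
have /zpi_eq : zpi (zrepr (zpi x)) = zpi x by rewrite zreprK.
move=> /(_ [set y | f y = 0]) H; apply/subr0_eq; rewrite -fB; apply: H.
split=> [|y /fX//]; split=> // a b /= fa fb; by rewrite fB fa fb subr0.
Qed.
End ZQuot.

Definition ideal (R : pzRingType) (I : set R) : Prop :=
  subgrp I /\ forall a x b, I x -> I (a * x * b).

Definition idspan (R : pzRingType) (X : set R) : set R := smallest (@ideal R) X.

Lemma idspan_ideal (R : pzRingType) (X : set R) : ideal (idspan X).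
Proof.
split; first split.
- by move=> Y [[[]]].
- move=> x y Xx Xy Y HY; have [[[_ YB] _] _] := HY.
  by apply: YB; [apply: Xx | apply: Xy].
- by move=> a x b Xx Y HY; have [[_ YM] _] := HY; apply: YM; apply: Xx.
Qed.

Section IdQuot.
Variables (R : pzRingType) (X : set R).

Definition idquot : Type := zquot (idspan X).
HB.instance Definition _ := GRing.Zmodule.on idquot.

Definition rpi (x : R) : idquot := zpi (idspan X) x.
Definition rrepr (u : idquot) : R := zrepr u.

Lemma rreprK u : rpi (rrepr u) = u.
Proof. exact: zreprK. Qed.

Lemma rpi_eq x y : rpi x = rpi y <-> idspan X (x - y).
Proof. by rewrite /rpi zpi_eq zspan_id //; case: (idspan_ideal X). Qed.

HB.instance Definition _ := GRing.Additive.copy rpi (zpi (idspan X)).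

Lemma rpi_eq0 x : rpi x = 0 <-> idspan X x.
Proof. by rewrite -(raddf0 rpi) rpi_eq subr0. Qed.

Let one : idquot := rpi 1.
Let mul (u v : idquot) : idquot := rpi (rrepr u * rrepr v).

Let mulE x y : mul (rpi x) (rpi y) = rpi (x * y).
Proof.
have [Isub IM] := idspan_ideal X.
have rK z : idspan X (rrepr (rpi z) - z) by apply/rpi_eq; rewrite rreprK.
apply/rpi_eq; set x' := rrepr _; set y' := rrepr _.
have -> : x' * y' - x * y = 1 * (x' - x) * y' + x * (y' - y) * 1.
  by rewrite mul1r mulr1 mulrBl mulrBr addrA addrNK.
by apply: (subgrpD Isub); apply: IM; apply: rK.
Qed.

Let mulA : associative mul.
Proof.
by move=> u v w; rewrite -(rreprK u) -(rreprK v) -(rreprK w) !mulE mulrA.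
Qed.
Let mul1 : left_id one mul.
Proof. by move=> u; rewrite -(rreprK u) mulE mul1r. Qed.
Let mulr1 : right_id one mul.
Proof. by move=> u; rewrite -(rreprK u) mulE mulr1. Qed.
Let mulDl : left_distributive mul +%R.
Proof.
move=> u v w; rewrite -(rreprK u) -(rreprK v) -(rreprK w) -raddfD !mulE.
by rewrite mulrDl raddfD.
Qed.
Let mulDr : right_distributive mul +%R.
Proof.
move=> u v w; rewrite -(rreprK u) -(rreprK v) -(rreprK w) -raddfD !mulE.
by rewrite mulrDr raddfD.
Qed.

HB.instance Definition _ :=
  GRing.Zmodule_isPzRing.Build idquot mulA mul1 mulr1 mulDl mulDr.

Lemma rpi_is_monoid_morphism : monoid_morphism rpi.
Proof. by split=> // x y; rewrite -mulE. Qed.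
HB.instance Definition _ :=
  GRing.isMonoidMorphism.Build R idquot rpi rpi_is_monoid_morphism.
End IdQuot.

(* B as a left S-module along h. *)
Definition lres (S B : pzRingType) (h : {rmorphism S -> B}) : Type := B.

Section RestrictionOfScalars.
Variables (S B : pzRingType) (h : {rmorphism S -> B}).
Local Notation lres := (lres h).

HB.instance Definition _ := GRing.Zmodule.on lres.

Let lres_scale (s : S) (b : lres) : lres := h s * (b : B).
Let lresA a b v : lres_scale a (lres_scale b v) = lres_scale (a * b) v.
Proof. by rewrite /lres_scale mulrA rmorphM. Qed.
Let lres1 : left_id 1 lres_scale.
Proof. by move=> v; rewrite /lres_scale rmorph1 mul1r. Qed.
Let lresDr : right_distributive lres_scale +%R.
Proof. by move=> a u v; rewrite /lres_scale mulrDr. Qed.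
Let lresDl v : {morph lres_scale^~ v : a b / a + b}.
Proof. by move=> a b; rewrite /lres_scale rmorphD mulrDl. Qed.
HB.instance Definition _ :=
  GRing.Zmodule_isLmodule.Build S lres lresA lres1 lresDr lresDl.

Lemma lresE (s : S) (b : lres) : s *: b = h s * (b : B) :> B.
Proof. by []. Qed.
End RestrictionOfScalars.

Section FreeExtension.
Variables (K : choiceType) (M : zmodType) (f : K -> M).

(* The additive extension of f to the free abelian group on K. *)
Definition fgext (w : {freeg K}) : M := \sum_(k <- dom w) f k *~ coeff k w.

Lemma fgextE w : fgext w = fglift (f : K -> zmodule M) w.
Proof.
have lB := lift_is_additive (f : K -> zmodule M).
have l0 : fglift (f : K -> zmodule M) 0 = 0.
  by rewrite -[X in fglift _ X](subrr 0) lB subrr.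
have lD : {morph fglift (f : K -> zmodule M) : u v / u + v}.
  move=> u v; have -> : u + v = u - (0 - v) by rewrite sub0r opprK.
  by rewrite !lB l0 sub0r opprK.
rewrite -[in RHS](freeg_sumE w) (big_morph _ lD l0).
by apply: eq_bigr => k _; rewrite liftU scalezrE.
Qed.

Lemma fgext_is_zmod_morphism : zmod_morphism fgext.
Proof. by move=> u v; rewrite !fgextE lift_is_additive. Qed.
HB.instance Definition _ :=
  GRing.isZmodMorphism.Build {freeg K} M fgext fgext_is_zmod_morphism.

Lemma fgextU k : fgext << k >> = f k.
Proof. by rewrite fgextE liftU scale1r. Qed.
End FreeExtension.

Section Tensor.
Variables (S B : pzRingType) (h : {rmorphism S -> B}) (V : lmodType S).

Inductive tens_rel : {freeg (B * V)} -> Prop :=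
| TensDl a b v : tens_rel (<< (a + b, v) >> - << (a, v) >> - << (b, v) >>)
| TensDr b v w : tens_rel (<< (b, v + w) >> - << (b, v) >> - << (b, w) >>)
| TensM b s v : tens_rel (<< (b * h s, v) >> - << (b, s *: v) >>).

(* B (x)_S V, where S acts on the right of B through h. *)
Definition tens : Type := zquot tens_rel.
HB.instance Definition _ := GRing.Zmodule.on tens.

Definition tpure (b : B) (v : V) : tens := zpi tens_rel << (b, v) >>.

Definition balanced (M : zmodType) (f : B -> V -> M) : Prop :=
  [/\ forall a b v, f (a + b) v = f a v + f b v,
      forall b v w, f b (v + w) = f b v + f b w
    & forall b s v, f (b * h s) v = f b (s *: v)].

(* The additive map with b (x) v |-> f b v, for balanced f; see tens_recE. *)
Definition tens_rec (M : zmodType) (f : B -> V -> M) (w : tens) : M :=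
  fgext (fun p => f p.1 p.2) (zrepr w).

Lemma tpure_balanced : balanced tpure.
Proof.
have tens0 x : tens_rel x -> zpi tens_rel x = 0.
  by move=> Hx; apply/zpi_eq0; apply: sub_gen_smallest.
split=> [a b v|b v w|b s v]; apply/subr0_eq.
- by rewrite opprD addrA -!raddfB; apply/tens0/TensDl.
- by rewrite opprD addrA -!raddfB; apply/tens0/TensDr.
- by rewrite -!raddfB; apply/tens0/TensM.
Qed.

Lemma tens_rec_zpi (M : zmodType) (f : B -> V -> M) : balanced f ->
  forall x, tens_rec f (zpi tens_rel x) = fgext (fun p => f p.1 p.2) x.
Proof.
move=> [fDl fDr fM] x; apply: zrepr_lift; first exact: fgext_is_zmod_morphism.
by move=> _ [a b v|b v w|b s v]; rewrite !raddfB /= !fgextU /= (fDl, fDr, fM)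
  ?subrr // addrAC addrK subrr.
Qed.

Lemma tens_recE (M : zmodType) (f : B -> V -> M) : balanced f ->
  forall b v, tens_rec f (tpure b v) = f b v.
Proof. by move=> fb b v; rewrite /tpure tens_rec_zpi // fgextU. Qed.

Lemma tens_rec_zmod_morphism (M : zmodType) (f : B -> V -> M) :
  balanced f -> zmod_morphism (tens_rec f).
Proof.
move=> fb u v; have [x <-] := zpi_surj u; have [y <-] := zpi_surj v.
by rewrite -raddfB !tens_rec_zpi // raddfB.
Qed.

Lemma tens_ind (Q : tens -> Prop) :
  Q 0 -> (forall u v, Q u -> Q v -> Q (u - v)) ->
  (forall b v, Q (tpure b v)) -> forall u, Q u.
Proof.
move=> Q0 QB Qp u; have [x <-] := zpi_surj u.
have QN v : Q v -> Q (- v) by move=> Qv; rewrite -[- v]add0r; apply: QB.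
have QD v w : Q v -> Q w -> Q (v + w).
  by move=> Qv Qw; rewrite -[w]opprK; apply: QB => //; apply: QN.
have QM n v : Q v -> Q (v *~ n).
  move=> Qv; have Qn m : Q (v *+ m).
    by elim: m => [|m IH]; rewrite ?mulr0n // mulrS; apply: QD.
  by case: n => n; [apply: Qn | rewrite NegzE mulrNz; apply/QN/Qn].
rewrite -(freeg_sumE x) raddf_sum; apply: big_ind => // -[b v] _ /=.
have -> : << coeff (b, v) x *g (b, v) >> = << (b, v) >> *~ coeff (b, v) x.
  by rewrite freeg_mulz intz.
rewrite raddfMz; exact/QM/Qp.
Qed.

Lemma tens_ext (M : zmodType) (f g : tens -> M) :
  zmod_morphism f -> zmod_morphism g ->
  (forall b v, f (tpure b v) = g (tpure b v)) -> f =1 g.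
Proof.
move=> fB gB fg; apply: tens_ind => [|u v fu fv|//]; last by rewrite fB gB fu fv.
by rewrite -[0](subrr 0) fB gB !subrr.
Qed.

Let act (b : B) : tens -> tens := tens_rec (fun a v => tpure (b * a) v).

Let act_balanced b : balanced (fun a v => tpure (b * a) v).
Proof.
have [tDl tDr tM] := tpure_balanced.
by split=> *; rewrite ?mulrDr ?mulrA ?tDl ?tDr ?tM.
Qed.
Let actE b a v : act b (tpure a v) = tpure (b * a) v.
Proof. exact: (tens_recE (act_balanced b)). Qed.
Let actB b : zmod_morphism (act b).
Proof. exact: tens_rec_zmod_morphism. Qed.
Let act0 b : act b 0 = 0.
Proof. by rewrite -[X in act _ X](subrr 0) actB subrr. Qed.

Let actA a b u : act a (act b u) = act (a * b) u.
Proof.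
move: u; apply: tens_ext => [u v|u v|c v]; rewrite ?actB //.
by rewrite !actE mulrA.
Qed.
Let act1 : left_id 1 act.
Proof.
by move=> u; apply: (tens_ext _ (g := id)) => [x y|//|c v];
  rewrite ?actB ?actE ?mul1r.
Qed.
Let actDr : right_distributive act +%R.
Proof.
move=> a u v; have -> : u + v = u - (0 - v) by rewrite sub0r opprK.
by rewrite !actB act0 sub0r opprK.
Qed.
Let actDl u : {morph act^~ u : a b / a + b}.
Proof.
move=> a b; move: u; apply: tens_ext => [x y|x y|c v].
- exact: actB.
- by rewrite !actB opprD addrACA.
- by rewrite !actE mulrDl; have [-> _ _] := tpure_balanced.
Qed.

HB.instance Definition _ :=
  GRing.Zmodule_isLmodule.Build B tens actA act1 actDr actDl.

Lemma tens_scaleE b a v : b *: tpure a v = tpure (b * a) v.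
Proof. exact: actE. Qed.

(* The degree n part of B (x)_S V for gradings GB of B and GV of V. *)
Definition tens_deg (GB : nat -> set B) (GV : nat -> set V) (n : nat) : set tens :=
  zspan [set w | exists i j b v,
    [/\ (i + j = n)%N, GB i b, GV j v & w = tpure b v]].
End Tensor.

Definition projective (S : pzRingType) (V : lmodType S) : Prop :=
  forall (M N : lmodType S) (g : {linear M -> N}) (f : {linear V -> N}),
    (forall y, exists x, g x = y) ->
    exists f' : {linear V -> M}, forall v, g (f' v) = f v.

Record grading (M : zmodType) := Grading {
  gproj :> nat -> {additive M -> M};
  gprojK : forall i j x, gproj i (gproj j x) = if i == j then gproj j x else 0;
  gproj_sum : forall x, exists n, x = \sum_(i < n) gproj i x
}.

Section Grading.
Variables (M : zmodType) (G : grading M).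

Definition homog (n : nat) : set M := [set x | G n x = x].

(* The direct sum of the components of degree < n, so that degree <= n is
   [below n.+1]. *)
Definition below (n : nat) : set M := [set x | x = \sum_(i < n) G i x].

Lemma homog_gproj i x : homog i (G i x).
Proof. by rewrite /homog /= gprojK eqxx. Qed.

Lemma homog_neq i j x : homog i x -> i != j -> G j x = 0.
Proof. by move=> /= <- /negPf ne; rewrite gprojK eq_sym ne. Qed.

Lemma homog_subgrp n : subgrp (homog n).
Proof.
by split=> [|x y]; rewrite /homog /= ?raddf0 // => hx hy; rewrite raddfB hx hy.
Qed.

Lemma below_subgrp n : subgrp (below n).
Proof.
rewrite /below; split=> [|x y] /=; first by rewrite big1 // => i; rewrite raddf0.
by move=> hx hy; rewrite {1}hx {1}hy -sumrB; apply: eq_bigr => i; rewrite raddfB.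
Qed.

Lemma homog_below m n x : homog m x -> (m < n)%N -> below n x.
Proof.
move=> hx lt_mn; rewrite /below /= (bigD1 (Ordinal lt_mn)) //= hx big1 ?addr0 //.
move=> i ne; apply: (homog_neq hx); apply: contra ne => /eqP mi.
by apply/eqP/val_inj; rewrite /= mi.
Qed.

(* The largest degree of a nonzero component of x, and 0 if x = 0. *)
Definition gdeg (x : M) : nat :=
  xget 0%N [set d | G d x <> 0 /\ forall i, (d < i)%N -> G i x = 0].

Lemma gproj_sumW x n :
  (forall i, (n <= i)%N -> G i x = 0) -> x = \sum_(i < n) G i x.
Proof.
move=> G0; have [m xE] := gproj_sum G x.
rewrite {1}xE -!(big_mkord xpredT (fun i => G i x)).
have -> : \sum_(0 <= i < m) G i x = \sum_(0 <= i < maxn m n) G i x.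
  rewrite [RHS](@big_cat_nat _ _ _ m) ?leq_maxl //= [X in _ + X]big_nat_cond.
  rewrite [X in _ + X]big1 ?addr0 // => i; rewrite andbT => /andP[le_i _].
  rewrite xE raddf_sum big1 // => j _; apply: (homog_neq (homog_gproj _ _)).
  by rewrite neq_ltn (leq_trans (ltn_ord j) le_i).
rewrite [LHS](@big_cat_nat _ _ _ n) ?leq_maxr //= [X in _ + X]big_nat_cond.
by rewrite [X in _ + X]big1 ?addr0 // => i; rewrite andbT => /andP[/G0].
Qed.

Lemma gdeg_below x : below (gdeg x).+1 x.
Proof.
rewrite /gdeg; case: xgetP => [d _ [_ G0]|Nd]; first exact: gproj_sumW.
apply: gproj_sumW => i _; apply: contrapT => Gi.
have [m xE] := gproj_sum G x.
have lt_m j : G j x != 0 -> (j <= m)%N.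
  rewrite xE raddf_sum; apply: contraR; rewrite -ltnNge => lt_mj.
  rewrite big1 // => l _; apply: (homog_neq (homog_gproj _ _)).
  by rewrite neq_ltn (ltn_trans (ltn_ord l) lt_mj).
have exd : exists j, G j x != 0 by exists i; apply/eqP.
have [d /eqP Gd max_d] := ex_maxnP exd lt_m.
apply: (Nd d); split=> // j lt_dj; apply: contrapT => /eqP /max_d.
by rewrite leqNgt lt_dj.
Qed.
End Grading.

Definition graded_map (M N : Type) (GM : nat -> set M) (GN : nat -> set N)
    (f : M -> N) : Prop :=
  forall n x, GM n x -> GN n (f x).

(* The degree n part of the shift X(-1). *)
Definition shift_down (M : zmodType) (GM : nat -> set M) (n : nat) : set M :=
  if n is n'.+1 then GM n' else [set 0].

Definition mulset (R : pzRingType) (X Y : set R) : set R :=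
  zspan [set x * y | x in X & y in Y].

Record csgring (S : nzRingType) := CSGRing {
  csg_ring :> nzRingType;
  csg_unit : {rmorphism S -> csg_ring};
  csg_grading : grading csg_ring;
  csg_unit_inj : injective csg_unit;
  csg_connected : range csg_unit = homog csg_grading 0;
  csg_strong : forall n m,
    mulset (homog csg_grading n) (homog csg_grading m) =
    homog csg_grading (n + m)
}.

Section CsgTheory.
Variables (S : nzRingType) (T : csgring S).
Local Notation p := (csg_grading T).
Local Notation Tn := (homog (csg_grading T)).

Lemma homogM i j x y : Tn i x -> Tn j y -> Tn (i + j)%N (x * y).
Proof.
move=> hx hy; rewrite -csg_strong; apply: sub_gen_smallest.
by exists x => //; exists y.
Qed.

Lemma homog_unit s : Tn 0%N (csg_unit T s).
Proof. by rewrite -csg_connected; exists s. Qed.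

Lemma gprojM3 n a x b : exists N, p n (a * x * b) =
  \sum_(i < N) \sum_(j < N) \sum_(k < N | (i + j + k)%N == n)
     p i a * p j x * p k b.
Proof.
have ext (y : T) : exists N0, forall N, (N0 <= N)%N -> y = \sum_(i < N) p i y.
  have [N0 yE] := gproj_sum p y; exists N0 => N le_N; apply: gproj_sumW => i le_i.
  rewrite yE raddf_sum big1 // => j _; apply: (homog_neq (homog_gproj _ _ _)).
  by rewrite neq_ltn (leq_trans (ltn_ord j) (leq_trans le_N le_i)).
have [Na aE] := ext a; have [Nx xE] := ext x; have [Nb bE] := ext b.
pose N := (Na + Nx + Nb)%N; exists N.
have {aE} aE := aE N ltac:(by rewrite /N -addnA leq_addr).
have {xE} xE := xE N ltac:(by rewrite /N addnAC leq_addl).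
have {bE} bE := bE N ltac:(by rewrite /N leq_addl).
rewrite {1}aE mulr_suml mulr_suml raddf_sum; apply: eq_bigr => i _.
rewrite {1}xE mulr_sumr mulr_suml raddf_sum; apply: eq_bigr => j _.
rewrite {1}bE mulr_sumr raddf_sum [RHS]big_mkcond; apply: eq_bigr => k _.
have hom : Tn (i + j + k)%N (p i a * p j x * p k b).
  by do 2?apply: homogM; apply: homog_gproj.
case: eqP => [<-|ne]; first exact: hom.
by apply: (homog_neq hom); apply/eqP.
Qed.
End CsgTheory.

Section Deformation.
Variables (S : nzRingType) (T : csgring S).
Local Notation iota := (csg_unit T).
Local Notation p := (csg_grading T).
Local Notation Tn := (homog (csg_grading T)).
Local Notation Tlt := (below (csg_grading T)).

Definition subbimodule (P : set T) : Prop :=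
  [/\ subgrp P, forall s x, P x -> P (iota s * x)
    & forall x s, P x -> P (x * iota s)].

Variable P : set T.

Definition Ple (n : nat) : set T := P `&` Tlt n.+1.
Definition RP_deg (n : nat) : set T := p n @` Ple n.
Definition RP : set T := [set x | forall n, RP_deg n (p n x)].

Definition U := idquot P.
Definition Ufil (n : nat) : set U := rpi P @` Tlt n.

(* Ufil n is U^{<= n-1}; U^{<= n} / U^{<= n-1} is the image of U^{<= n} in U / U^{<= n-1}. *)
Definition gr_deg (n : nat) : set (zquot (Ufil n)) :=
  zpi (Ufil n) @` Ufil n.+1.

(* gr U(P) as the finitely supported families. Its multiplication is not needed:
   Phi below is a ring map, so it is an isomorphism iff it is bijective. *)
Definition grU : set (forall n, zquot (Ufil n)) :=
  [set g | (forall n, gr_deg (g n)) /\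
           exists N, forall n, (N <= n)%N -> g n = 0].

Definition A := idquot RP.
HB.instance Definition _ := GRing.PzRing.on A.
Definition A_deg (n : nat) : set A := rpi RP @` Tn n.

(* The value does not depend on the representative; see PhiE. *)
Definition Phi (a : A) : forall n, zquot (Ufil n) :=
  fun n => zpi (Ufil n) (rpi P (p n (rrepr a))).

Lemma Ufil_subgrp n : subgrp (Ufil n).
Proof.
have [b0 bB] := below_subgrp p n.
split=> [|_ _ [x bx <-] [y by_ <-]]; first by exists 0; rewrite ?raddf0.
by exists (x - y); [apply: bB | rewrite raddfB].
Qed.

Lemma PhiE x n : Phi (rpi RP x) n = zpi (Ufil n) (rpi P (p n x)).
Proof.
pose I : set T := [set y | forall m, Ufil m (rpi P (p m y))].
suff [Isub RI] : ideal I /\ RP `<=` I.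
  have IK : I (rrepr (rpi RP x) - x).
    have /rpi_eq : rpi RP (rrepr (rpi RP x)) = rpi RP x by rewrite rreprK.
    by move/(_ I); apply; split.
  by apply/zpi_eq; rewrite -!raddfB zspan_id; [apply: IK | apply: Ufil_subgrp].
split; first split.
- split=> [|y z Iy Iz] m; first by rewrite !raddf0; apply: (Ufil_subgrp m).1.
  by rewrite !raddfB; apply: (Ufil_subgrp m).2; [apply: Iy | apply: Iz].
- move=> a y b Iy m; have [N ->] := gprojM3 m a y b.
  rewrite raddf_sum; apply: (subgrp_sum (Ufil_subgrp m)) => i _.
  rewrite raddf_sum; apply: (subgrp_sum (Ufil_subgrp m)) => j _.
  rewrite raddf_sum; apply: (subgrp_sum (Ufil_subgrp m)) => k /eqP <-.
  have [t bt tE] := Iy j; exists (p i a * t * p k b); last first.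
    by rewrite /= !rmorphM /= tE.
  rewrite bt mulr_sumr mulr_suml; apply: (subgrp_sum (below_subgrp p _)) => l _.
  apply: (@homog_below _ _ (i + l + k)%N); last by rewrite ltn_add2r ltn_add2l.
  by do 2?apply: homogM; apply: homog_gproj.
- move=> y RPy m; have [t [Pt bt] <-] := RPy m.
  move: bt; rewrite /below /= big_ord_recr /= => tE.
  exists (- \sum_(i < m) p i t).
    apply: (subgrpN (below_subgrp p m)).
    apply: (subgrp_sum (below_subgrp p m)) => i _.
    exact: (homog_below (homog_gproj _ _ _)).
  rewrite raddfN; apply/esym/eqP; rewrite -addr_eq0 -raddfD addrC -tE.
  by apply/eqP/rpi_eq0; apply: sub_gen_smallest.
Qed.

Definition PBW_type : Prop := set_bij [set: A] grU Phi.

Definition Pjac (n : nat) : set T :=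
  zspan [set t | exists i j k a x b,
    [/\ (i + j + k = n)%N, Tlt i.+1 a, Ple j x, Tlt k.+1 b & t = a * x * b]].

Definition jacobi (n : nat) : Prop := Pjac n.+1 `&` Tlt n.+1 `<=` Pjac n.

Definition star (a : T) : {poly T} :=
  \sum_(i < (gdeg p a).+1) (p i a)%:P * 'X^(gdeg p a - i).

Definition Tz_deg (n : nat) : set {poly T} :=
  [set f | forall i, if (i <= n)%N then Tn (n - i)%N f`_i else f`_i = 0].

Definition D := idquot (star @` P).
HB.instance Definition _ := GRing.PzRing.on D.
Definition D_deg (n : nat) : set D := rpi (star @` P) @` Tz_deg n.
Definition zD : D := rpi (star @` P) 'X.

Definition etaA : {rmorphism S -> A} := rpi RP \o iota.
Definition etaD : {rmorphism S -> D} := rpi (star @` P) \o (@polyC T) \o iota.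

(* The projection D -> A with z |-> 0; see piDAE. *)
Definition piDA (d : D) : A := rpi RP (rrepr d)`_0.

Lemma star0_RP x : subgrp P -> P x -> RP (star x)`_0.
Proof.
move=> Psub Px n; set d := gdeg p x.
have -> : (star x)`_0 = p d x.
  rewrite /star coef_sum big_ord_recr /= -/d subnn expr0 mulr1 coefC eqxx.
  rewrite big1 ?add0r // => i _; rewrite coefMXn subn_gt0.
  by rewrite ltn_ord.
rewrite gprojK; case: eqP => [->|_].
  by exists x => //; split=> //; apply: gdeg_below.
exists 0; last exact: raddf0.
by split; [apply: Psub.1 | apply: (below_subgrp p _).1].
Qed.

Lemma piDAE (f : {poly T}) :
  subgrp P -> piDA (rpi (star @` P) f) = rpi RP f`_0.
Proof.
move=> Psub; pose I : set {poly T} := [set g | idspan RP g`_0].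
have [[i0 iB] iM] := idspan_ideal RP.
have /rpi_eq : rpi (star @` P) (rrepr (rpi (star @` P) f)) = rpi (star @` P) f.
  by rewrite rreprK.
move=> /(_ I) IK; apply/rpi_eq; rewrite -coefB; apply: IK; split.
  split; first split; rewrite /I /=.
  - by rewrite coef0.
  - by move=> g h; rewrite coefB; apply: iB.
  - by move=> a g b; rewrite !coef0M; apply: iM.
by move=> _ [x Px <-]; apply: sub_gen_smallest; apply: star0_RP.
Qed.

Lemma piDA_zmod_morphism : subgrp P -> zmod_morphism piDA.
Proof.
move=> Psub u v; rewrite -(rreprK u) -(rreprK v) -raddfB !piDAE //.
by rewrite coefB raddfB.
Qed.

Lemma piDA_monoid_morphism : subgrp P -> monoid_morphism piDA.
Proof.
move=> Psub; split=> [|u v].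
  by rewrite -[1](rmorph1 (rpi (star @` P))) piDAE // coef1 eqxx rmorph1.
rewrite -(rreprK u) -(rreprK v) -[X in piDA X]rmorphM !piDAE //.
by rewrite coef0M rmorphM.
Qed.

Lemma piDA_zD : subgrp P -> piDA zD = 0.
Proof. by move=> Psub; rewrite piDAE // coefX raddf0. Qed.

Lemma piDA_eta s : subgrp P -> piDA (etaD s) = etaA s.
Proof. by move=> Psub; rewrite piDAE //= coefC eqxx. Qed.

(* The projection A -> A^0 = S; see d0E. *)
Definition d0 (a : A) : S :=
  xget 0 [set s | exists2 x, rpi RP x = a & p 0%N x = iota s].

Lemma d0E x s :
  P `&` Tn 0%N = [set 0] -> p 0%N x = iota s -> d0 (rpi RP x) = s.
Proof.
move=> P0 xs; rewrite /d0; case: xgetP => [t _ [y yx ys]|]; last first.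
  by move=> /(_ s) H; exfalso; apply: H; exists x.
apply: (@csg_unit_inj _ T); rewrite -xs -ys; apply/subr0_eq; rewrite -raddfB.
move/rpi_eq: yx => /(_ [set y | p 0%N y = 0]); apply; split.
  split; first split.
  - exact: raddf0.
  - by move=> u v /= u0 v0; rewrite raddfB u0 v0 subr0.
  - move=> a u b /= u0; have [N ->] := gprojM3 0 a u b.
    rewrite big1 // => i _; rewrite big1 // => j _; rewrite big1 // => k.
    rewrite -addnA addn_eq0 addn_eq0 => /andP[_ /andP[/eqP -> _]].
    by rewrite u0 mulr0 mul0r.
move=> z /(_ 0%N) [u [Pu bu] uz]; rewrite /= -uz.
have : (P `&` Tn 0%N) u.
  by split=> //; move: bu; rewrite /below /= big_ord1 => /esym.
by rewrite P0 => ->; rewrite raddf0.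
Qed.

Definition A1pred : {pred lres etaA} := fun a => `[< A_deg 1 a >].

Lemma A1pred_closed : submod_closed A1pred.
Proof.
have [h0 hB] := homog_subgrp p 1.
split=> [|s a b]; first by apply/asboolP; exists 0; rewrite ?raddf0.
move=> /asboolP[x hx xa] /asboolP[y hy yb]; apply/asboolP.
exists (iota s * x + y); last by rewrite raddfD /= rmorphM /= xa yb.
apply: (subgrpD (homog_subgrp p 1)) => //.
by rewrite -[1%N]add0n; apply: homogM => //; apply: homog_unit.
Qed.

HB.instance Definition _ :=
  GRing.isSubmodClosed.Build S (lres etaA) A1pred A1pred_closed.

Definition A1 : Type := {a : lres etaA | a \in A1pred}.
HB.instance Definition _ := SubType.on A1.
HB.instance Definition _ := Choice.on A1.
HB.instance Definition _ := [SubChoice_isSubLmodule of A1 by <:].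

Definition A1val (a : A1) : A := val a.

(* A^1 is concentrated in degree 1. *)
Definition A1_deg (i : nat) : set A1 := if i == 1%N then setT else [set 0].

Definition d1 : tens etaA A1 -> A := tens_rec (fun a v => a * A1val v).

Lemma d1_balanced : balanced etaA (fun a (v : A1) => a * A1val v).
Proof.
split=> [a b v|b v w|b s v]; rewrite ?mulrDl //.
- by rewrite -mulrDr.
- by rewrite -mulrA.
Qed.

Definition ker (M N : zmodType) (f : M -> N) : set M := f @^-1` [set 0].

(* The resolution
   ... -> A (x) V_3 -> A (x) V_2 -> A (x) A^1 -> A -> S -> 0.
   The module [res_V n] is V_{n+2}, and [res_d n] is d_{n+3}. *)
Record resolution := Resolution {
  res_V : nat -> lmodType S;
  res_gr : forall n, grading (res_V n);
  res_grZ : forall n i s v, res_gr n i (s *: v) = s *: res_gr n i v;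
  res_proj : forall n, projective (res_V n);
  res_d2 : {linear tens etaA (res_V 0) -> tens etaA A1};
  res_d : forall n, {linear tens etaA (res_V n.+1) -> tens etaA (res_V n)};
  res_d2_graded :
    graded_map (tens_deg A_deg (homog (res_gr 0))) (tens_deg A_deg A1_deg) res_d2;
  res_d_graded : forall n,
    graded_map (tens_deg A_deg (homog (res_gr n.+1)))
               (tens_deg A_deg (homog (res_gr n))) (res_d n);
  res_exact_S : range d0 = setT;
  res_exact_A : ker d0 = range d1;
  res_exact1 : ker d1 = range res_d2;
  res_exact2 : ker res_d2 = range (res_d 0);
  res_exact : forall n, ker (res_d n) = range (res_d n.+1)
}.

(* pi (x) V; see piDA_tensE. *)
Definition piDA_tens (V : lmodType S) : tens etaD V -> tens etaA V :=
  tens_rec (fun x v => tpure etaA (piDA x) v).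

Lemma piDA_tens_balanced (V : lmodType S) : subgrp P ->
  balanced etaD (fun x (v : V) => tpure etaA (piDA x) v).
Proof.
move=> Psub; have [tDl tDr tM] := tpure_balanced etaA V.
split=> [a b v|b v w|b s v]; rewrite ?tDr //.
- have -> : a + b = a - (0 - b) by rewrite sub0r opprK.
  rewrite !piDA_zmod_morphism // -tDl.
  by rewrite -[0](subrr 0) !piDA_zmod_morphism // !subrr sub0r opprK.
- by rewrite (piDA_monoid_morphism Psub).2 piDA_eta // tM.
Qed.

Lemma piDA_tensE (V : lmodType S) x (v : V) : subgrp P ->
  piDA_tens (tpure etaD x v) = tpure etaA (piDA x) v.
Proof. by move=> Psub; apply: tens_recE; apply: piDA_tens_balanced. Qed.

Section Complex.
Variable K : resolution.
Local Notation V2 := (res_V K 0).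

(* sigma^1, partial_2 and f_2. *)
Record lifting := Lifting {
  lift_sigma : {linear A1 -> lres etaD};
  lift_d2 : {linear tens etaD V2 -> tens etaD A1};
  lift_f2 : {linear tens etaD V2 -> D^o};
  lift_sigma_deg : forall a, D_deg 1 (lift_sigma a);
  lift_sigmaK : forall a, piDA (lift_sigma a) = A1val a;
  lift_d1 : tens etaD A1 -> D := tens_rec (fun x a => x * (lift_sigma a : D));
  lift_d2_graded :
    graded_map (tens_deg D_deg (homog (res_gr K 0))) (tens_deg D_deg A1_deg)
               lift_d2;
  lift_d2E : forall w, piDA_tens (lift_d2 w) = res_d2 K (piDA_tens w);
  lift_f2_graded :
    graded_map (tens_deg D_deg (homog (res_gr K 0)))
               (shift_down (D_deg : nat -> set D^o)) lift_f2;
  lift_f2E : forall w, lift_d1 (lift_d2 w) = - (zD * (lift_f2 w : D))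
}.

Variable L : lifting.

Lemma lift_d1_balanced :
  balanced etaD (fun x (a : A1) => x * (lift_sigma L a : D)).
Proof.
split=> [a b v|b v w|b s v]; rewrite ?mulrDl //.
- by rewrite raddfD mulrDr.
- by rewrite linearZ /= lresE mulrA.
Qed.

Definition delta1 (m : tens etaD A1 * D) : D := lift_d1 L m.1 + zD * m.2.

Definition delta2 (m : tens etaD V2 * tens etaD A1) : tens etaD A1 * D :=
  (lift_d2 L m.1 - zD *: m.2, lift_d1 L m.2 + (lift_f2 L m.1 : D)).

Definition H1_zero : Prop := ker delta1 = range delta2.
End Complex.
End Deformation.

(* The default -1 is the value on the empty set, i.e. for M = 0. *)
Definition complexity (M : zmodType) (G : grading M) : \bar int :=
  supremum (-1)%:E [set (n%:Z - 1)%:E | n in [set n | homog G n <> [set 0]]].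

(* Main.v *)
(* Setting z = 1 identifies D^n with T^{<=n} / P_n, so that (J_n) says exactly
   that z is injective on D^n; comparing leading terms, P is of PBW-type iff
   (J_n) holds for every n, that is, iff z is regular on D.

   If z is regular, a cycle of 1M maps to a cycle of the resolution of S over A;
   lifting a preimage under d_2 turns it into some (0, u) with z u = 0, so
   u = 0.

   Conversely, if z u = 0 then (0, u) is a boundary. The Jacobi conditions up to
   c_{V_3} make the obstruction to extending 1M by a lift of d_3 vanish, whence
   u = partial_1 t with z t = 0. As A^1 is projective, t lies in
   ker z (x) A^1, so that ker z = (ker z) D^1. Iterating, every element of ker z
   lives in arbitrarily high degree and is therefore 0. *)

From HB Require Import structures.
Require Import Defs.
From mathcomp Require Import all_boot all_order all_algebra.
From mathcomp Require Import boolp classical_sets functions constructive_ereal.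
From mathcomp.multinomials Require Import freeg.

Set Implicit Arguments.
Unset Strict Implicit.
Unset Printing Implicit Defensive.

Import Order.TTheory GRing.Theory Num.Theory.

Local Open Scope classical_set_scope.
Local Open Scope ring_scope.

(** * Gradings and the Rees embedding of T[z] *)

Section Grading.
Variables (M : zmodType) (G : grading M).

Lemma below0 n : below G n 0.
Proof. by have [] := below_subgrp G n. Qed.

Lemma belowP n x : below G n x <-> forall i, (n <= i)%N -> G i x = 0.
Proof.
split=> [xE i le_ni|]; last exact: gproj_sumW.
rewrite xE raddf_sum big1 // => j _; apply: (homog_neq (homog_gproj _ _ _)).
by rewrite neq_ltn (leq_trans (ltn_ord j) le_ni).
Qed.

Lemma below_mono m n x : (m <= n)%N -> below G m x -> below G n x.
Proof.
move=> le_mn /belowP x0; apply/belowP => i /(leq_trans le_mn); exact: x0.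
Qed.

Lemma gproj_sum_wide n x :
  exists2 N, (n <= N)%N & x = \sum_(i < N) G i x.
Proof.
have [m xE] := gproj_sum G x; exists (maxn n m); first exact: leq_maxl.
exact: below_mono (leq_maxr _ _) xE.
Qed.

Lemma below_subproj n x : below G n.+1 x -> below G n (x - G n x).
Proof.
move=> /belowP x0; apply/belowP => i le_ni; rewrite raddfB gprojK.
case: eqP => [->|/eqP ne]; first by rewrite subrr.
by rewrite subr0 x0 // ltn_neqAle eq_sym ne.
Qed.

End Grading.

Section GradedRing.
Variables (S : nzRingType) (T : csgring S).
Local Notation p := (csg_grading T).
Local Notation Tn := (homog (csg_grading T)).
Local Notation Tlt := (below (csg_grading T)).

Lemma gproj_homogMl i n a b : Tn i a ->
  p n (a * b) = if (i <= n)%N then a * p (n - i)%N b else 0.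
Proof.
move=> ha; have [N lt_nN bE] := gproj_sum_wide p n.+1 b.
rewrite [in LHS]bE mulr_sumr raddf_sum.
have pE (j : 'I_N) : p n (a * p j b) = if (i + j == n)%N then a * p j b else 0.
  have h := homogM ha (homog_gproj p j b).
  by case: eqP => [<-|/eqP ne]; [exact: h | exact: homog_neq h ne].
rewrite (eq_bigr _ (fun j _ => pE j)) -big_mkcond /=.
case: leqP => [le_in|lt_ni]; last first.
  by rewrite big_pred0 // => j; rewrite gtn_eqF // ltn_addr.
have lt_N : (n - i < N)%N by apply: leq_ltn_trans lt_nN; apply: leq_subr.
rewrite (big_pred1 (Ordinal lt_N)) // => j /=.
by rewrite -{1}(subnKC le_in) eqn_add2l.
Qed.

Lemma gprojM n a b : p n (a * b) = \sum_(i < n.+1) p i a * p (n - i)%N b.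
Proof.
have [N lt_nN aE] := gproj_sum_wide p n.+1 a.
rewrite [in LHS]aE mulr_suml raddf_sum.
under eq_bigr => i _ do rewrite (gproj_homogMl _ _ (homog_gproj p i a)).
rewrite -big_mkcond /= (big_ord_widen N (fun i => p i a * p (n - i)%N b)) //.
Qed.

Lemma belowM i j a b : Tlt i.+1 a -> Tlt j.+1 b -> Tlt (i + j).+1 (a * b).
Proof.
move=> /belowP a0 /belowP b0; apply/belowP => n lt_n; rewrite gprojM.
rewrite big1 // => k _.
have [le_ki|/a0->] := leqP k i; last by rewrite mul0r.
rewrite b0 ?mulr0 // ltn_subRL; apply: leq_ltn_trans lt_n.
by rewrite leq_add2r.
Qed.

Lemma gproj1 n : p n 1 = if n == 0%N then 1 else 0.
Proof.
have h : Tn 0%N 1 by have := homog_unit T 1; rewrite rmorph1.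
by case: n => [|n]; [exact: h | exact: homog_neq h _].
Qed.

(** This is the coaction of the grading on [T], with the polynomial variable recording degrees; it
    is multiplicative by the convolution formula [gprojM]. *)
Definition expand (a : T) : {poly T} := \poly_(i < (gdeg p a).+1) p i a.

Lemma coef_expand a n : (expand a)`_n = p n a.
Proof.
rewrite coef_poly; case: ltnP => // le_n.
by have /belowP -> := gdeg_below p a.
Qed.

Fact expand_is_zmod_morphism : zmod_morphism expand.
Proof. by move=> a b; apply/polyP => n; rewrite coefB !coef_expand raddfB. Qed.
HB.instance Definition _ :=
  GRing.isZmodMorphism.Build T {poly T} expand expand_is_zmod_morphism.

Fact expand_is_monoid_morphism : monoid_morphism expand.
Proof.
split=> [|a b]; apply/polyP => n; rewrite coef_expand.
  by rewrite gproj1 coef1; case: eqP.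
by rewrite coefM gprojM; apply: eq_bigr => i _; rewrite !coef_expand.
Qed.
HB.instance Definition _ :=
  GRing.isMonoidMorphism.Build T {poly T} expand expand_is_monoid_morphism.

Fact expand_comm : commr_rmorph expand 'X.
Proof. by move=> a; apply/esym/commr_polyX. Qed.

(* The ring embedding T[z] -> T[y] with a |-> sum_n p^n(a) y^n and z |-> y: the
   n-th coefficient of [rees f] is the degree n part of f at z = 1. *)
Definition rees : {rmorphism {poly T} -> {poly T}} := horner_morph expand_comm.

Lemma reesX : rees 'X = 'X.
Proof. exact: horner_morphX. Qed.

Lemma coef_rees f n : (rees f)`_n = \sum_(i < n.+1) p (n - i)%N f`_i.
Proof.
rewrite /rees /= /horner_morph.
have szN : (size (map_poly expand f) <= maxn (size f) n.+1)%N.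
  by rewrite (leq_trans (size_poly _ _)) ?leq_maxl.
rewrite (horner_coef_wide _ szN) coef_sum.
rewrite (big_ord_widen _ (fun i => p (n - i)%N f`_i) (leq_maxr (size f) n.+1)).
rewrite [RHS]big_mkcond; apply: eq_bigr => i _.
rewrite coefMXn coef_map_id0 ?raddf0 // coef_expand ltnS.
by case: leqP.
Qed.

(** In the coefficient of index m + i, the coefficient of index j of f contributes only in degree m
    + i - j, so degree m isolates j = i. Hence f can be read off from [rees f]. *)
Lemma gproj_rees f i m : p m (rees f)`_(m + i) = p m f`_i.
Proof.
rewrite coef_rees raddf_sum.
have lt_i : (i < (m + i).+1)%N by rewrite ltnS leq_addl.
rewrite (bigD1 (Ordinal lt_i)) //= addnK gprojK eqxx big1 ?addr0 // => j ne.
rewrite gprojK; case: eqP => // mE; case/eqP: ne; apply: val_inj => /=.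
by apply/eqP; rewrite -(eqn_add2l m) {1}mE subnK // -ltnS.
Qed.

Lemma rees_inj : injective rees.
Proof.
move=> f g fg; apply/polyP => i.
have [N fE] := gproj_sum p (f - g)`_i.
apply/subr0_eq; rewrite -coefB fE big1 // => m _.
by rewrite coefB raddfB -[p m f`_i]gproj_rees fg gproj_rees subrr.
Qed.

Lemma coef_rees_below f n : Tlt n.+1 (rees f)`_n.
Proof.
rewrite coef_rees; apply: (subgrp_sum (below_subgrp p _)) => i _.
by apply: (homog_below (homog_gproj _ _ _)); rewrite ltnS leq_subr.
Qed.

(* The homogenization of t in total degree n, for t of degree <= n. *)
Definition hom (n : nat) (t : T) : {poly T} := \poly_(i < n.+1) p (n - i)%N t.

Fact hom_is_zmod_morphism n : zmod_morphism (hom n).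
Proof.
move=> a b; apply/polyP => i; rewrite coefB !coef_poly.
by case: ifP; rewrite ?subr0 ?raddfB.
Qed.
HB.instance Definition _ n :=
  GRing.isZmodMorphism.Build T {poly T} (hom n) (hom_is_zmod_morphism n).

(** Homogenizations become monomials under [rees]. As [rees] is injective, identities between
    homogenized elements reduce to monomial arithmetic. *)
Lemma rees_hom n t : Tlt n.+1 t -> rees (hom n t) = t%:P * 'X^n.
Proof.
move=> bt; apply/polyP => m; rewrite coef_rees coefCM coefXn.
have -> : \sum_(i < m.+1) p (m - i)%N (hom n t)`_i =
          \sum_(i < m.+1) if m == n then p (n - i)%N t else 0.
  apply: eq_bigr => i _; rewrite coef_poly ltnS.
  have le_im : (i <= m)%N by rewrite -ltnS.
  case: leqP => [le_in|lt_ni]; last first.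
    by rewrite raddf0 gtn_eqF // (leq_trans lt_ni).
  rewrite gprojK; congr (if _ then _ else _).
  by rewrite -(eqn_add2r i) !subnK.
case: eqP => [->|_]; last by rewrite big1 ?mulr0.
rewrite mulr1 [RHS]bt (reindex_inj rev_ord_inj) /=.
by apply: eq_bigr => i _; rewrite subSS subKn // -ltnS.
Qed.

Lemma hom_deg n t : Tz_deg n (hom n t).
Proof.
by move=> i; rewrite coef_poly ltnS; case: leqP => // _; apply: homog_gproj.
Qed.

(** Together with [rees_hom] this identifies the degree n part of T[z] with the elements of T of
    degree at most n, by setting z = 1. *)
Lemma hom_rees n (f : {poly T}) : Tz_deg n f -> hom n (rees f)`_n = f.
Proof.
move=> hf; apply/polyP => i; have := hf i; rewrite coef_poly ltnS.
case: leqP => [le_in|_ ->//].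
by rewrite -[X in (rees f)`_X](subnK le_in) gproj_rees.
Qed.

Lemma coef_rees_deg n m (f : {poly T}) :
  Tz_deg n f -> m != n -> (rees f)`_m = 0.
Proof.
move=> /hom_rees <- ne; rewrite rees_hom; last exact: coef_rees_below.
by rewrite coefCM coefXn (negPf ne) mulr0.
Qed.

Lemma hom0_coef n t : (hom n t)`_0 = p n t.
Proof. by rewrite coef_poly subn0. Qed.

Lemma star_hom x : star x = hom (gdeg p x) x.
Proof.
rewrite /hom poly_def /star (reindex_inj rev_ord_inj) /=.
apply: eq_bigr => i _; rewrite subSS subKn; last by rewrite -ltnS.
by rewrite -mul_polyC.
Qed.

Lemma rees_star x : rees (star x) = x%:P * 'X^(gdeg p x).
Proof. by rewrite star_hom rees_hom //; apply: gdeg_below. Qed.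

Lemma gdeg_min n x : Tlt n.+1 x -> (gdeg p x <= n)%N.
Proof.
(* If no leading degree exists, [gdeg] takes its default value 0 and the bound is trivial. *)
move=> /belowP x0; rewrite /gdeg; case: xgetP => [d _ [nz _]|_] //.
by rewrite leqNgt; apply/negP => /x0.
Qed.

End GradedRing.

Arguments rees {S T}.

(** * Jacobi conditions, torsion and PBW-type *)

Lemma monomM (R : nzRingType) (a b : R) i j :
  (a%:P * 'X^i) * (b%:P * 'X^j) = (a * b)%:P * 'X^(i + j).
Proof.
by rewrite -mulrA [_ * (b%:P * _)]mulrA -commr_polyXn polyCM exprD !mulrA.
Qed.

Section Jacobi.
Variables (S : nzRingType) (T : csgring S) (P : set T).
Local Notation p := (csg_grading T).
Local Notation Tlt := (below (csg_grading T)).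
Local Notation starI := (idspan (@star S T @` P)).

Lemma Pjac_subgrp n : subgrp (Pjac P n).
Proof. exact: zspan_subgrp. Qed.

Lemma Pjac_gen i j k a x b : Tlt i.+1 a -> P x -> Tlt j.+1 x -> Tlt k.+1 b ->
  Pjac P (i + j + k) (a * x * b).
Proof.
by move=> ha Px hx hb; apply: sub_gen_smallest; exists i, j, k, a, x, b.
Qed.

Lemma Pjac_ind n (Y : set T) : subgrp Y ->
  (forall i j k a x b, (i + j + k = n)%N -> Tlt i.+1 a -> P x -> Tlt j.+1 x ->
     Tlt k.+1 b -> Y (a * x * b)) -> Pjac P n `<=` Y.
Proof.
move=> Ysub Ygen; apply: smallest_sub => // t.
by move=> [i [j [k [a [x [b [e ha [Px hx] hb ->]]]]]]]; apply: Ygen e _ _ _ _.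
Qed.

Lemma below1 n : Tlt n.+1 1.
Proof. by apply/belowP => -[|i] // _; rewrite gproj1. Qed.

Lemma Pjac_mem n x : P x -> Tlt n.+1 x -> Pjac P n x.
Proof.
move=> Px hx; have := Pjac_gen (below1 0) Px hx (below1 0).
by rewrite mul1r mulr1 addn0.
Qed.

Lemma Pjac_below n : Pjac P n `<=` Tlt n.+1.
Proof.
apply: Pjac_ind => [|i j k a x b <- ha _ hx hb]; first exact: below_subgrp.
by apply: belowM => //; apply: belowM.
Qed.

Lemma Pjac_mul i j k a y b : Tlt i.+1 a -> Pjac P j y -> Tlt k.+1 b ->
  Pjac P (i + j + k) (a * y * b).
Proof.
move=> ha hy hb; have [Q0 QB] := Pjac_subgrp (i + j + k).
apply: (@Pjac_ind j [set y | Pjac P (i + j + k) (a * y * b)]) hy => /=.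
  split=> /= [|u v hu hv]; first by rewrite mulr0 mul0r.
  by rewrite mulrBr mulrBl; apply: QB.
move=> i' j' k' a' x b' <- ha' Px hx hb'.
rewrite !mulrA -[_ * b' * b]mulrA.
have -> : (i + (i' + j' + k') + k = (i + i') + j' + (k' + k))%N.
  by rewrite !addnA.
by apply: Pjac_gen => //; apply: belowM.
Qed.

Lemma Pjac_mono m n : (m <= n)%N -> Pjac P m `<=` Pjac P n.
Proof.
move=> le_mn y hy; have := Pjac_mul (below1 0) hy (below1 (n - m)).
by rewrite mul1r mulr1 add0n subnKC.
Qed.

Lemma Pjac_idspan n : Pjac P n `<=` idspan P.
Proof.
have [Isub IM] := idspan_ideal P.
apply: Pjac_ind => // i j k a x b _ _ Px _ _; apply: IM.
exact: sub_gen_smallest.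
Qed.

(** Homogenization is additive, so the generators a x b of P_n suffice, and these factor through
    [star x]. *)
Lemma hom_Pjac n y : Pjac P n y -> starI (hom n y).
Proof.
have [[I0 IB] IM] := idspan_ideal (@star S T @` P).
apply: (@Pjac_ind n [set y | starI (hom n y)]).
  by split=> /= [|u v hu hv]; rewrite ?raddf0 // raddfB; apply: IB.
move=> i j k a x b <- ha Px hx hb /=.
(* The bound j may exceed the true degree of x; a power of z makes up the difference. *)
have -> : hom (i + j + k) (a * x * b) =
          hom i a * (1 * star x * 'X^(j - gdeg p x)) * hom k b.
  have leg := gdeg_min hx; rewrite mul1r; apply: rees_inj.
  rewrite !rmorphM rmorphXn /= reesX rees_star !rees_hom //; last first.
    by do 2?apply: belowM.
  by rewrite -[x%:P * _ * _]mulrA -exprD subnKC // !monomM.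
apply: (IM); apply: IM; apply: sub_gen_smallest; by exists x.
Qed.

(** The image of the ideal generated by P* under [rees] consists of the elements of the Rees ring
    with n-th coefficient in P_n for all n. One direction holds because this condition defines an
    ideal containing P*, the other by homogenizing the coefficients of [rees f]. *)
Lemma idspan_starP (f : {poly T}) : starI f <-> forall n, Pjac P n (rees f)`_n.
Proof.
split=> [|hf].
  move/(_ [set f : {poly T} | forall n, Pjac P n (rees f)`_n]); apply.
  split; first split; first split.
  - by move=> n; rewrite raddf0 coef0; apply: (Pjac_subgrp n).1.
  - move=> g h hg hh n; rewrite raddfB coefB; apply: (Pjac_subgrp n).2.
      exact: hg.
    exact: hh.
  - move=> a g b hg n; rewrite !rmorphM coefM.
    apply: (subgrp_sum (Pjac_subgrp n)) => l _; rewrite coefM mulr_suml.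
    apply: (subgrp_sum (Pjac_subgrp n)) => i _.
    have h : Pjac P (i + (l - i) + (n - l))
                 ((rees a)`_i * (rees g)`_(l - i) * (rees b)`_(n - l)).
      by apply: Pjac_mul; try exact: coef_rees_below; apply: hg.
    have le_il : (i <= l)%N by rewrite -ltnS.
    have le_ln : (l <= n)%N by rewrite -ltnS.
    by rewrite !subnKC // in h.
  - move=> _ [x Px <-] n; rewrite rees_star coefCM coefXn.
    case: eqP => [->|_]; last by rewrite mulr0; apply: (Pjac_subgrp n).1.
    by rewrite mulr1; apply: Pjac_mem => //; apply: gdeg_below.
have -> : f = \sum_(n < size (rees f)) hom n (rees f)`_n.
  apply: rees_inj; rewrite raddf_sum /= -[LHS]coefK poly_def.
  apply: eq_bigr => n _; rewrite rees_hom; last exact: coef_rees_below.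
  by rewrite mul_polyC.
apply: (subgrp_sum (idspan_ideal _).1) => n _; exact: hom_Pjac.
Qed.

Lemma rpi_star_eq0 (f : {poly T}) :
  rpi (@star S T @` P) f = 0 <-> forall n, Pjac P n (rees f)`_n.
Proof. by rewrite rpi_eq0 idspan_starP. Qed.

Lemma coef_reesXM (f : {poly T}) n :
  (rees ('X * f))`_n = if n is m.+1 then (rees f)`_m else 0.
Proof. by rewrite rmorphM /= reesX coefXM; case: n. Qed.

Definition zD_regular : Prop := forall u : D P, zD P * u = 0 -> u = 0.

(** Multiplication by z shifts Rees coefficients by one, so membership in P_n is weakened to
    membership in P_{n+1}. The gap between the two is what the Jacobi condition closes. *)
Lemma zD_mul_eq0 (f : {poly T}) : zD P * rpi (@star S T @` P) f = 0 <->
  forall n, Pjac P n.+1 (rees f)`_n.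
Proof.
rewrite -rmorphM rpi_star_eq0; split=> [h n|h [|n]]; rewrite ?coef_reesXM //.
  by have := h n.+1; rewrite coef_reesXM.
exact: (Pjac_subgrp 0).1.
Qed.

Lemma jacobi_torsion n (u : D P) :
  jacobi P n -> D_deg n u -> zD P * u = 0 -> u = 0.
Proof.
move=> J [f hf <-] /zD_mul_eq0 h; apply/rpi_star_eq0 => m.
have [->|ne] := eqVneq m n; last first.
  by rewrite (coef_rees_deg hf ne); apply: (Pjac_subgrp m).1.
by apply: J; split; [apply: h | apply: coef_rees_below].
Qed.

Lemma zD_regularP : zD_regular <-> forall n, jacobi P n.
Proof.
split=> [reg n t [Pt bt]|J u].
  have /reg/rpi_star_eq0/(_ n) : zD P * rpi (@star S T @` P) (hom n t) = 0.
    apply/zD_mul_eq0 => m; rewrite rees_hom // coefCM coefXn.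
    case: eqP => [->|_]; first by rewrite mulr1.
    by rewrite mulr0; apply: (Pjac_subgrp _).1.
  by rewrite rees_hom // coefCM coefXn eqxx mulr1.
rewrite -[u]rreprK => /zD_mul_eq0 h; apply/rpi_star_eq0 => n.
by apply: J; split; [apply: h | apply: coef_rees_below].
Qed.

End Jacobi.

(** * Injectivity of [Phi] and the Jacobi conditions *)

Section PBW.
Variables (S : nzRingType) (T : csgring S) (P : set T).
Hypothesis Psub : subgrp P.
Local Notation p := (csg_grading T).
Local Notation Tlt := (below (csg_grading T)).
Local Notation starI := (idspan (@star S T @` P)).

Lemma idspan_star_coef0 (f : {poly T}) : starI f -> idspan (RP P) f`_0.
Proof.
move=> /rpi_eq0 f0; apply/rpi_eq0; rewrite -piDAE // f0.
by rewrite -(raddf0 (rpi (@star S T @` P))) piDAE // coef0 raddf0.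
Qed.

(** Constant terms of an ideal of T[z] form an ideal of T, and each generator of R_P is the constant
    term of some homogenized element of P. With [idspan_star_coef0] this amounts to D/zD = A. *)
Lemma idspan_RP_coef0 (r : T) :
  idspan (RP P) r -> exists2 f : {poly T}, starI f & f`_0 = r.
Proof.
have [[I0 IB] IM] := idspan_ideal (@star S T @` P).
pose Y : set T := [set r | exists2 f : {poly T}, starI f & f`_0 = r].
have YB : subgrp Y.
  split=> [|_ _ [f hf <-] [g hg <-]]; first by exists 0; rewrite ?coef0.
  by exists (f - g); [apply: IB | rewrite coefB].
move/(_ Y); apply; split=> [|y RPy].
  split=> // a _ b [f hf <-]; exists (a%:P * f * b%:P); first exact: IM.
  by rewrite coefMC coefCM.
have [N ->] := gproj_sum p y; apply: (subgrp_sum YB) => n _.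
have [x [Px bx] <-] := RPy n; exists (hom n x); last exact: hom0_coef.
by apply: hom_Pjac; apply: Pjac_mem.
Qed.

Lemma gproj_Pjac n y : Pjac P n y -> idspan (RP P) (p n y).
Proof. by move/hom_Pjac/idspan_star_coef0; rewrite hom0_coef. Qed.

(** With [gproj_Pjac]: the degree n part of the ideal generated by R_P consists exactly of the
    leading parts of P_n. *)
Lemma gproj_idspan_RP n r :
  idspan (RP P) r -> exists2 y, Pjac P n y & p n y = p n r.
Proof.
move=> /idspan_RP_coef0[f /idspan_starP hf <-]; exists (rees f)`_n => //.
by rewrite -[X in (rees f)`_X]addn0 gproj_rees.
Qed.

(** The P_n increase with n, and their union is an ideal containing P. *)
Lemma idspan_Pjac x : idspan P x -> exists n, Pjac P n x.
Proof.
have Pm i j : Pjac P i `<=` Pjac P (i + j) by apply: Pjac_mono; apply: leq_addr.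
move/(_ [set x | exists n, Pjac P n x]); apply; split=> [|y Py]; last first.
  by exists (gdeg p y); apply: Pjac_mem => //; apply: gdeg_below.
split; first split.
- by exists 0%N; apply: (Pjac_subgrp _ _).1.
- move=> y z [m hy] [n hz]; exists (m + n)%N; apply: (Pjac_subgrp _ _).2.
    exact: Pm.
  by rewrite addnC; apply: Pm.
- move=> a y b [n hy]; exists (gdeg p a + n + gdeg p b)%N.
  by apply: Pjac_mul => //; apply: gdeg_below.
Qed.

Lemma jacobi_idspan : (forall n, jacobi P n) ->
  forall n x, idspan P x -> Tlt n.+1 x -> Pjac P n x.
Proof.
move=> J n x /idspan_Pjac[m hx] bx.
have [le_mn|/ltnW le_nm] := leqP m n; first exact: Pjac_mono hx.
rewrite -(subnKC le_nm) in hx; elim: (m - n)%N hx => [|k IH]; rewrite ?addn0 //.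
rewrite addnS => hx; apply: IH; apply: J; split=> //.
by apply: below_mono bx; rewrite ltnS leq_addr.
Qed.

Lemma Phi_eq0 n x : Phi (rpi (RP P) x) n = 0 <->
  exists2 t, Tlt n t & idspan P (p n x - t).
Proof.
rewrite PhiE zpi_eq0 zspan_id; last exact: Ufil_subgrp.
split=> [[t bt e]|[t bt e]]; exists t => //.
  by apply/rpi_eq; rewrite e.
by apply/esym/rpi_eq.
Qed.

(** If the component of x in degree n agrees modulo P with some t of lower degree, the difference
    lies in P_n by the Jacobi conditions, and its leading part is that component. *)
Lemma Phi_inj : (forall n, jacobi P n) -> injective (@Phi S T P).
Proof.
move=> J a b ab; rewrite -[a]rreprK -[b]rreprK; apply/rpi_eq.
set x := rrepr a - rrepr b.
have Phi0 n : Phi (rpi (RP P) x) n = 0.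
  rewrite PhiE /x !raddfB /= -!PhiE !rreprK ab; exact: subrr.
have [N ->] := gproj_sum p x.
apply: (subgrp_sum (idspan_ideal _).1) => n _.
have /Phi_eq0[t bt ht] := Phi0 n.
have hy : Pjac P n (p n x - t).
  apply: jacobi_idspan => //; apply: (below_subgrp _ _).2.
    exact: homog_below (homog_gproj _ _ _) _.
  exact: below_mono bt.
have := gproj_Pjac hy; rewrite raddfB gprojK eqxx.
by have /belowP -> := bt; rewrite ?subr0.
Qed.

Lemma Phi_grU a : grU (@Phi S T P a).
Proof.
rewrite -[a]rreprK; split=> [n|].
  rewrite PhiE; exists (rpi P (p n (rrepr a))) => //.
  by exists (p n (rrepr a)) => //; apply: homog_below (homog_gproj _ _ _) _.
exists (gdeg p (rrepr a)).+1 => n le_n; rewrite PhiE.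
have /belowP -> := gdeg_below p (rrepr a) => //; by rewrite !raddf0.
Qed.

Lemma Phi_surj g : grU g -> exists a, @Phi S T P a = g.
Proof.
move=> [gd [N gN]].
have /choice[x hx] n :
    exists t, Tlt n.+1 t /\ zpi (@Ufil S T P n) (rpi P t) = g n.
  by have [_ [t bt <-] <-] := gd n; exists t.
(* Only the leading part of each representative matters, the rest having degree below n; N bounds
   the support of g and keeps the sum finite. *)
exists (rpi (RP P) (\sum_(n < N) p n (x n))).
apply: functional_extensionality_dep => n; rewrite PhiE raddf_sum.
have [lt_nN|le_Nn] := ltnP n N; last first.
  rewrite gN // big1 ?raddf0 // => i _; apply: homog_neq (homog_gproj _ _ _) _.
  by rewrite neq_ltn (leq_trans (ltn_ord i) le_Nn).
rewrite (bigD1 (Ordinal lt_nN)) //= gprojK eqxx big1 ?addr0; last first.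
  move=> i ne; apply: homog_neq (homog_gproj _ _ _) _.
  by apply: contra ne => /eqP e; apply/eqP/val_inj.
have [bx <-] := hx n; apply/esym/zpi_eq.
rewrite zspan_id; last exact: Ufil_subgrp.
by exists (x n - p n (x n)); rewrite ?raddfB //; apply: below_subproj.
Qed.

(** Induction on the degree of x in the ideal generated by P. Modulo that ideal its leading part
    equals an element of lower degree, so [Phi] kills it; injectivity makes it the leading part of
    some y in P_n, and x - y has lower degree. *)
Lemma Phi_inj_jacobi : injective (@Phi S T P) -> forall n, jacobi P n.
Proof.
move=> inj.
(* Here n is a strict degree bound, so n = m + 1 is the sharp case; leaving m free lets the
   induction keep its target P_m while the degree drops. *)
have E : forall n x, idspan P x -> Tlt n x ->
    forall m, (n <= m.+1)%N -> Pjac P m x.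
  elim=> [|n IH] x Ix bx m le_nm.
    by rewrite bx big_ord0; apply: (Pjac_subgrp _ _).1.
  have Rx : idspan (RP P) (p n x).
    apply/rpi_eq0/inj; apply: functional_extensionality_dep => i.
    rewrite -(raddf0 (rpi (RP P))) PhiE PhiE; apply/zpi_eq.
    rewrite zspan_id; last exact: Ufil_subgrp.
    rewrite !raddf0 addr0 gprojK; case: eqP => [->|_]; last first.
      by rewrite raddf0; apply: (Ufil_subgrp _ _).1.
    exists (p n x - x); last first.
      apply/rpi_eq; rewrite addrAC subrr add0r.
      exact: (subgrpN (idspan_ideal _).1 Ix).
    rewrite -opprB; apply: (subgrpN (below_subgrp _ _)); exact: below_subproj.
  have [y hy py] := gproj_idspan_RP n Rx; rewrite gprojK eqxx in py.
  have hyx : Pjac P m (x - y).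
    apply: IH; last exact: ltnW.
      by apply: (idspan_ideal _).1.2 => //; apply: Pjac_idspan hy.
    have -> : x - y = (x - y) - p n (x - y) by rewrite raddfB py subrr subr0.
    apply: below_subproj; apply: (below_subgrp _ _).2 => //.
    exact: Pjac_below hy.
  rewrite -[x](subrK y); apply: (subgrpD (Pjac_subgrp _ _)) => //.
  by apply: Pjac_mono hy; rewrite -ltnS.
by move=> n x [hx bx]; apply: (E n.+1) => //; apply: Pjac_idspan hx.
Qed.

Lemma PBW_typeP : PBW_type P <-> forall n, jacobi P n.
Proof.
split=> [[_ inj _]|J].
  by apply: Phi_inj_jacobi => a b; apply: inj; rewrite inE.
split=> [a _|a b _ _|g /Phi_surj[a <-]]; first exact: Phi_grU.
  exact: Phi_inj.
by exists a.
Qed.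

End PBW.

(** * Projective modules and tensor products *)

(** Maps such as [tens_rec] are additive only under hypotheses; this gives access to the [raddf]
    lemmas for them inside a proof. *)
Lemma zmod_morphism_additive (U V : zmodType) (f : U -> V) :
  zmod_morphism f -> exists g : {additive U -> V}, f =1 g.
Proof.
move=> fB; pose g : {additive U -> V} :=
  HB.pack f (GRing.isZmodMorphism.Build U V f fB).
by exists g.
Qed.

Section DualBasis.
Variables (S : nzRingType) (V : lmodType S).

Definition freeg_eval (w : {freeg V / S}) : V := fglift id w.

Fact freeg_eval_is_linear : linear freeg_eval.
Proof.
have evB : zmod_morphism freeg_eval by exact: lift_is_additive.
have [g gE] := zmod_morphism_additive evB.
move=> s u v; rewrite !gE raddfD; congr (_ + _).
have -> : s *: u = \sum_(k <- dom u) << s * coeff k u *g k >> by [].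
rewrite -[u in RHS]freeg_sumE !raddf_sum.
by apply: eq_bigr => k _; rewrite -!gE /freeg_eval !liftU /= scalerA.
Qed.
HB.instance Definition _ :=
  GRing.isLinear.Build S {freeg V / S} V *:%R freeg_eval freeg_eval_is_linear.

(** Any duplicate-free list containing the support may be summed over, so that the supports of
    several elements can be merged. *)
Lemma freeg_evalE (w : {freeg V / S}) (r : seq V) :
  uniq r -> {subset dom w <= r} -> freeg_eval w = \sum_(k <- r) coeff k w *: k.
Proof.
move=> ur sub; rewrite -[in LHS](freeg_sumE w) raddf_sum /=.
rewrite [RHS](bigID (fun k => k \in dom w)) /=.
rewrite [X in _ + X]big1 ?addr0; last first.
  by move=> k /coeff_outdom ->; rewrite scale0r.
rewrite -[RHS]big_filter; rewrite (perm_big [seq k <- r | k \in dom w]) /=.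
  by apply: eq_bigr => k _; rewrite /freeg_eval liftU.
apply: uniq_perm; rewrite ?uniq_dom ?filter_uniq // => k.
by rewrite mem_filter; case: (boolP (k \in dom w)) => // /sub ->.
Qed.

(** Projectivity splits the evaluation map from the free module on the set V onto V; the c k are the
    coordinates of the splitting. *)
Lemma projective_dual_basis : projective V ->
  exists c : V -> V -> S,
    [/\ forall k v w, c k (v + w) = c k v + c k w,
        forall k s v, c k (s *: v) = s * c k v
      & forall v, exists r : seq V, forall r' : seq V, uniq r' ->
          {subset r <= r'} -> v = \sum_(k <- r') c k v *: k].
Proof.
move=> pV; have [|s sK] := pV _ _ (freeg_eval : {linear _ -> _}) idfun.
  by move=> v; exists << v >>; apply: etrans (liftU _ _ _) (scale1r _).
exists (fun k v => coeff k (s v)); split=> [k v w|k a v|v].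
- by rewrite !raddfD.
- by rewrite linearZ coeffZ.
exists (dom (s v)) => r ur sub.
by rewrite -freeg_evalE // [freeg_eval _]sK.
Qed.

End DualBasis.

Section TensorTorsion.
Variables (S : nzRingType) (B : pzRingType) (h : {rmorphism S -> B}).
Variables (V : lmodType S).
Local Notation tpure := (tpure h).

Lemma tpureBl a b (v : V) : tpure (a - b) v = tpure a v - tpure b v.
Proof.
have [tDl _ _] := tpure_balanced h V.
by apply/esym/eqP; rewrite subr_eq -tDl subrK.
Qed.

Lemma tpure0l (v : V) : tpure 0 v = 0.
Proof. by rewrite -(subrr 0) tpureBl subrr. Qed.

Lemma tpureDr a (v w : V) : tpure a (v + w) = tpure a v + tpure a w.
Proof. by have [_ ->] := tpure_balanced h V. Qed.

Lemma tpure0r a : tpure a (0 : V) = 0.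
Proof. by apply: (addrI (tpure a 0)); rewrite -tpureDr !addr0. Qed.

Lemma tpure_sumr a (I : Type) (r : seq I) (F : I -> V) :
  tpure a (\sum_(i <- r) F i) = \sum_(i <- r) tpure a (F i).
Proof. exact: (big_morph _ (tpureDr a) (tpure0r a)). Qed.

(* The c k are the coordinates of t with respect to a dual basis of V. *)
Lemma projective_tens_torsion (b : B) (t : tens h V) :
  projective V -> b *: t = 0 ->
  exists (r : seq V) (c : V -> B),
    (forall k, b * c k = 0) /\ t = \sum_(k <- r) tpure (c k) k.
Proof.
move=> /projective_dual_basis[c [cD cZ cE]] bt0.
have bal k : balanced h (fun d v => d * h (c k v)).
  by split=> *; rewrite ?mulrDl ?cD ?rmorphD ?mulrDr // cZ rmorphM mulrA.
pose C k : tens h V -> B := tens_rec (fun d v => d * h (c k v)).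
have CB k : zmod_morphism (C k) by apply: tens_rec_zmod_morphism (bal k).
have C0 k : C k 0 = 0 by rewrite -[X in C k X](subrr 0) CB subrr.
(* The coordinate maps are left B-linear, so b t = 0 forces b to kill every coordinate of t. *)
have CZ k : C k (b *: t) = b * C k t.
  move: t {bt0}; apply: tens_ind => [|u v hu hv|d v].
  - by rewrite scaler0 C0 mulr0.
  - by rewrite scalerBr !CB hu hv mulrBr.
  - by rewrite tens_scaleE /C !tens_recE // mulrA.
have [r rE] : exists r : seq V, forall r', uniq r' -> {subset r <= r'} ->
    t = \sum_(k <- r') tpure (C k t) k.
  move: t {bt0 CZ}; apply: tens_ind => [|u v [r1 h1] [r2 h2]|d v].
  - exists [::] => r _ _; rewrite big1 // => k _.
    by rewrite C0 tpure0l.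
  - exists (r1 ++ r2) => r ur sub.
    have sub1 : {subset r1 <= r} by move=> k hk; apply: sub; rewrite mem_cat hk.
    have sub2 : {subset r2 <= r}.
      by move=> k hk; apply: sub; rewrite mem_cat hk orbT.
    rewrite {1}(h1 r ur sub1) {1}(h2 r ur sub2).
    by rewrite -sumrB; apply: eq_bigr => k _; rewrite CB tpureBl.
  - have [r hr] := cE v; exists r => r' ur sub.
    rewrite {1}(hr r') // tpure_sumr.
    apply: eq_bigr => k _; rewrite /C tens_recE //.
    by have [_ _ ->] := tpure_balanced h V.
exists (undup r), (C ^~ t); split=> [k|].
  by rewrite -CZ bt0.
by apply: rE => [|k]; rewrite ?undup_uniq ?mem_undup.
Qed.

End TensorTorsion.

(** * The central extension *)

Section CentralExtension.
Variables (S : nzRingType) (T : csgring S) (P : set T).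
Hypothesis Psub : subgrp P.
Local Notation p := (csg_grading T).
Local Notation Tlt := (below (csg_grading T)).
Local Notation starI := (idspan (@star S T @` P)).
Local Notation rpiD := (rpi (@star S T @` P)).
Local Notation D := (D P).
Local Notation etaD := (etaD P).
Local Notation etaA := (etaA P).

Lemma zD_central (u : D) : zD P * u = u * zD P.
Proof. by rewrite -[u]rreprK -!rmorphM /= commr_polyX. Qed.

Lemma D_deg_subgrp n : subgrp (@D_deg S T P n).
Proof.
have hom_rpi t : Tlt n.+1 t -> D_deg n (rpiD (hom n t)).
  by exists (hom n t) => //; apply: hom_deg.
split=> [|_ _ [f hf <-] [g hg <-]].
  by rewrite -(raddf0 rpiD) -(raddf0 (hom n)); apply/hom_rpi/below0.
rewrite -raddfB -(hom_rees hf) -(hom_rees hg) -raddfB; apply: hom_rpi.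
by apply: (below_subgrp _ _).2; apply: coef_rees_below.
Qed.

Lemma homM i j a b : Tlt i.+1 a -> Tlt j.+1 b ->
  hom i a * hom j b = hom (i + j) (a * b).
Proof.
move=> ha hb; apply: rees_inj; rewrite rmorphM /= !rees_hom ?monomM //.
exact: belowM.
Qed.

Lemma D_degM i j (u v : D) : D_deg i u -> D_deg j v -> D_deg (i + j) (u * v).
Proof.
move=> [f hf <-] [g hg <-]; rewrite -rmorphM -(hom_rees hf) -(hom_rees hg).
rewrite homM; try exact: coef_rees_below.
by exists (hom (i + j) ((rees f)`_i * (rees g)`_j)) => //; apply: hom_deg.
Qed.

Lemma Pjac_rrepr n (f : {poly T}) :
  Pjac P n ((rees (rrepr (rpiD f)))`_n - (rees f)`_n).
Proof.
have /rpi_star_eq0/(_ n) : rpiD (rrepr (rpiD f) - f) = 0.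
  by rewrite raddfB /= rreprK subrr.
by rewrite raddfB coefB.
Qed.

(** The projection onto the degree n part of D, computed on representatives; [DprojE] shows
    independence of the choice. *)
Definition Dproj (n : nat) (u : D) : D := rpiD (hom n (rees (rrepr u))`_n).

Lemma DprojE n (f : {poly T}) : Dproj n (rpiD f) = rpiD (hom n (rees f)`_n).
Proof.
by apply/rpi_eq; rewrite -raddfB; apply: hom_Pjac; apply: Pjac_rrepr.
Qed.

Fact Dproj_is_zmod_morphism n : zmod_morphism (Dproj n).
Proof.
move=> u v; rewrite -[u]rreprK -[v]rreprK -raddfB !DprojE -!raddfB.
by rewrite -coefB -raddfB.
Qed.
HB.instance Definition _ n :=
  GRing.isZmodMorphism.Build D D (Dproj n) (Dproj_is_zmod_morphism n).

Lemma Dproj_deg n u : D_deg n (Dproj n u).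
Proof.
exists (hom n (rees (rrepr u))`_n) => //; exact: hom_deg.
Qed.

Lemma Dproj_id n u : D_deg n u -> Dproj n u = u.
Proof. by move=> [f hf <-]; rewrite DprojE hom_rees. Qed.

Lemma hom_X n t : Tlt n.+1 t -> 'X * hom n t = hom n.+1 t.
Proof.
move=> ht; apply: rees_inj; rewrite rmorphM /= reesX !rees_hom //.
  by rewrite mulrA -commr_polyX -mulrA -exprS.
exact: below_mono ht.
Qed.

Lemma Dproj_zD n u : Dproj n.+1 (zD P * u) = zD P * Dproj n u.
Proof.
rewrite -[u]rreprK -rmorphM !DprojE coef_reesXM -rmorphM hom_X //.
exact: coef_rees_below.
Qed.

Lemma Dproj_eta n u s : Dproj n (u * etaD s) = Dproj n u * etaD s.
Proof.
have etaE : etaD s = rpiD (csg_unit T s)%:P by [].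
have hs : Tlt 1 (csg_unit T s) by apply: homog_below (homog_unit _ _) _.
have Cs : (csg_unit T s)%:P = hom 0 (csg_unit T s).
  apply/polyP => -[|i]; rewrite coefC coef_poly //=.
  exact/esym/homog_unit.
rewrite -[u]rreprK etaE -rmorphM !DprojE -rmorphM Cs; congr rpiD.
rewrite homM ?addn0 //; last exact: coef_rees_below.
by congr hom; rewrite rmorphM /= rees_hom // expr0 mulr1 coefMC.
Qed.

(* The elements of D with no component in degree < m. *)
Definition Dfil (m : nat) (u : D) : Prop :=
  forall n, (n < m)%N -> Pjac P n (rees (rrepr u))`_n.

Lemma DfilP m (f : {poly T}) :
  Dfil m (rpiD f) <-> forall n, (n < m)%N -> Pjac P n (rees f)`_n.
Proof.
have E n := @Pjac_rrepr n f.
split=> h n /h hn.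
  rewrite -[X in Pjac P n X](subKr (rees (rrepr (rpiD f)))`_n).
  by apply: (Pjac_subgrp P n).2 (E n); exact: hn.
rewrite -[X in Pjac P n X](subrK (rees f)`_n).
by apply: (subgrpD (Pjac_subgrp P n)) (E n) _.
Qed.

Lemma Dfil_subgrp m : subgrp (Dfil m).
Proof.
split=> [|u v].
  by rewrite -(raddf0 rpiD); apply/DfilP => n _; rewrite raddf0 coef0;
    apply: (Pjac_subgrp P n).1.
rewrite -[u]rreprK -[v]rreprK -raddfB => /DfilP hu /DfilP hv.
apply/DfilP => n lt.
by rewrite raddfB coefB; apply: (Pjac_subgrp P n).2; [apply: hu | apply: hv].
Qed.

(** Under [rees] an element of D^1 is a monomial of exponent 1 whose coefficient has degree at most
    1, so multiplying by it carries P_n in index n to P_{n+1} in index n + 1. *)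
Lemma DfilM m u v : Dfil m u -> D_deg 1 v -> Dfil m.+1 (u * v).
Proof.
move=> hu [g hg <-]; rewrite -[u]rreprK -rmorphM; apply/DfilP => n lt_n.
rewrite rmorphM /= -(hom_rees hg) rees_hom; last exact: coef_rees_below.
rewrite mulrA expr1 coefMX coefMC; case: n lt_n => [|n] lt_n /=.
  exact: (Pjac_subgrp P 0).1.
rewrite -[_ * (rees g)`_1]mul1r mulrA -addn1 -[n]add0n.
by apply: Pjac_mul; [exact: below1 | apply: hu | exact: coef_rees_below].
Qed.

Lemma Dfil_eq0 u : (forall m, Dfil m u) -> u = 0.
Proof.
rewrite -[u]rreprK => hu; apply/rpi_star_eq0 => n.
by have /DfilP := hu n.+1; apply.
Qed.

Lemma piDA_additive : exists g : {additive D -> A P}, @piDA S T P =1 g.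
Proof. by apply: zmod_morphism_additive; apply: piDA_zmod_morphism. Qed.

Lemma piDA_surj n a : A_deg n a -> exists2 u : D, D_deg n u & piDA u = a.
Proof.
move=> [x hx <-]; exists (rpiD x%:P); last by rewrite piDAE // coefC.
exists x%:P => // i; rewrite coefC; case: i => [|i] /=; first by rewrite subn0.
by case: ifP => // _; apply: (homog_subgrp p _).1.
Qed.

(** A set-theoretic section of the projection to A, additive and multiplicative modulo z. *)
Definition Dlift (a : A P) : D := rpiD (rrepr a)%:P.

Lemma DliftK a : piDA (Dlift a) = a.
Proof. by rewrite piDAE // coefC /= rreprK. Qed.

Lemma piDA_ker (u : D) : piDA u = 0 -> exists v, u = zD P * v.
Proof.
rewrite -[u]rreprK piDAE //; set f := rrepr u => /rpi_eq0/idspan_RP_coef0.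
move=> [g /rpi_eq0 g0 gf].
(* Subtracting g does not change the class of f in D but cancels the constant term, so what remains
   is divisible by z. *)
exists (rpiD (drop_poly 1 (f - g))); rewrite -rmorphM -commr_polyX.
have -> : drop_poly 1 (f - g) * 'X = f - g.
  apply/polyP => -[|i]; rewrite coefMX ?coef_drop_poly ?addn1 //=.
  by rewrite coefB gf subrr.
by rewrite raddfB /= [rpi _ g]g0 subr0.
Qed.

(** * Base change from D to A on tensor products, and degree projections *)

Section Tensor.
Variable V : lmodType S.
Local Notation piV := (@piDA_tens S T P V).

Lemma piDA_tens_zmod_morphism : zmod_morphism piV.
Proof. by apply: tens_rec_zmod_morphism; apply: piDA_tens_balanced. Qed.

Lemma piDA_tens_additive :
  exists g : {additive tens etaD V -> tens etaA V}, piV =1 g.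
Proof. exact/zmod_morphism_additive/piDA_tens_zmod_morphism. Qed.

Lemma piDA_tensZ b w : piV (b *: w) = piDA b *: piV w.
Proof.
have [g gE] := piDA_tens_additive; rewrite !gE.
elim/tens_ind: w => [|u v hu hv|d v]; first by rewrite scaler0 raddf0 scaler0.
  by rewrite scalerBr !raddfB /= hu hv.
rewrite tens_scaleE -!gE !piDA_tensE // tens_scaleE.
by rewrite (piDA_monoid_morphism Psub).2.
Qed.

(** A homogeneous lift is needed to keep the obstruction in [d3_lift_homog] in a single degree. *)
Lemma piDA_tens_lift (GV : nat -> set V) n w : tens_deg (@A_deg S T P) GV n w ->
  exists2 x, tens_deg (@D_deg S T P) GV n x & piV x = w.
Proof.
have [g gE] := piDA_tens_additive.
pose Y : set (tens etaA V) :=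
  [set w | exists2 x, tens_deg (@D_deg S T P) GV n x & piV x = w].
move: w; apply: (@smallest_sub _ _ _ Y) => [|_ [i [j [b [v [e hb hv ->]]]]]].
  split=> [|_ _ [x hx <-] [y hy <-]].
    by exists 0; [exact: (zspan_subgrp _).1 | rewrite gE raddf0].
  by exists (x - y); [exact: (zspan_subgrp _).2 | rewrite !gE raddfB].
have [u hu <-] := piDA_surj hb; exists (tpure etaD u v); last exact: piDA_tensE.
by apply: sub_gen_smallest; exists i, j, u, v.
Qed.

Lemma piDA_tens_surj w : exists x, piV x = w.
Proof.
have [g gE] := piDA_tens_additive.
elim/tens_ind: w => [|_ _ [x <-] [y <-]|a v].
- by exists 0; rewrite gE raddf0.
- by exists (x - y); rewrite !gE raddfB.
- by exists (tpure etaD (Dlift a) v); rewrite piDA_tensE // DliftK.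
Qed.

Lemma piDA_tens_zD w : piV (zD P *: w) = 0.
Proof. by rewrite piDA_tensZ piDA_zD // scale0r. Qed.

(* Right exactness of the tensor product: the inverse of
   (D (x) V) / z (D (x) V) -> A (x) V sends a (x) v to the class of d (x) v
   for any d above a. *)
Lemma piDA_tens_ker w : piV w = 0 -> exists w', w = zD P *: w'.
Proof.
pose Z : set (tens etaD V) := [set w | exists w', w = zD P *: w'].
have Zsub : subgrp Z.
  split=> [|_ _ [x ->] [y ->]]; first by exists 0; rewrite scaler0.
  by exists (x - y); rewrite scalerBr.
pose f (a : A P) v := zpi Z (tpure etaD (Dlift a) v).
have pure0 u v : piDA u = 0 -> zpi Z (tpure etaD u v) = 0.
  move=> /piDA_ker[u' ->]; apply/zpi_eq0; rewrite zspan_id //.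
  by exists (tpure etaD u' v); rewrite tens_scaleE.
have [q qE] := piDA_additive.
have eqf u u' v : piDA u = piDA u' ->
    zpi Z (tpure etaD u v) = zpi Z (tpure etaD u' v).
  move=> e; apply/eqP; rewrite -subr_eq0 -raddfB -tpureBl; apply/eqP/pure0.
  by rewrite qE raddfB -!qE e subrr.
have [tDl tDr tM] := tpure_balanced etaD V.
have bal : balanced etaA f.
  split=> [a b v|b v v'|b s v]; rewrite /f.
  - by rewrite -raddfD /= -tDl; apply: eqf; rewrite [RHS]qE raddfD -!qE !DliftK.
  - by rewrite tDr raddfD.
  - rewrite -tM; apply: eqf.
    by rewrite DliftK (piDA_monoid_morphism Psub).2 DliftK piDA_eta.
have [g gE] := zmod_morphism_additive (tens_rec_zmod_morphism bal).
have [r rE] := piDA_tens_additive.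
have inv x : g (r x) = zpi Z x.
  elim/tens_ind: x => [|x y hx hy|d v]; first by rewrite !raddf0.
    by rewrite !raddfB /= hx hy.
  by rewrite -rE piDA_tensE // -gE tens_recE // /f; apply: eqf; rewrite DliftK.
move=> w0; have /esym : g (r w) = zpi Z w by [].
by rewrite -rE w0 raddf0 => /zpi_eq0; rewrite zspan_id.
Qed.

Lemma Dproj_balanced n :
  balanced etaD (fun b (v : V) => tpure etaD (Dproj n b) v).
Proof.
have [tDl tDr tM] := tpure_balanced etaD V.
by split=> *; rewrite ?raddfD ?tDl ?tDr // Dproj_eta tM.
Qed.

(** Projects the factor D alone. On the tensor product with A^1, which sits in degree 1, it selects
    total degree n + 1, whence the shift in [tproj_id]. *)
Definition tproj n : tens etaD V -> tens etaD V :=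
  tens_rec (fun b v => tpure etaD (Dproj n b) v).

Fact tproj_is_zmod_morphism n : zmod_morphism (tproj n).
Proof. exact: tens_rec_zmod_morphism (Dproj_balanced n). Qed.
HB.instance Definition _ n :=
  GRing.isZmodMorphism.Build (tens etaD V) (tens etaD V) (tproj n)
    (tproj_is_zmod_morphism n).

Lemma tprojE n b v : tproj n (tpure etaD b v) = tpure etaD (Dproj n b) v.
Proof. exact: tens_recE (Dproj_balanced n) _ _. Qed.

Lemma tproj_zD n w : tproj n.+1 (zD P *: w) = zD P *: tproj n w.
Proof.
elim/tens_ind: w => [|x y hx hy|d v]; first by rewrite scaler0 !raddf0.
  by rewrite scalerBr !raddfB /= hx hy.
by rewrite tens_scaleE !tprojE Dproj_zD tens_scaleE.
Qed.

End Tensor.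

Lemma tproj_id n w : tens_deg (@D_deg S T P) (@A1_deg S T P) n.+1 w ->
  tproj n w = w.
Proof.
have Y : subgrp [set w : tens etaD (A1 P) | tproj n w = w].
  split=> [|x y /= hx hy] /=; first exact: raddf0.
  by rewrite raddfB /= hx hy.
move: w; apply: (smallest_sub Y) => _ [i [j [b [v [e hb hv ->]]]]] /=.
move: hv e; rewrite /A1_deg; case: eqP => [-> _|_ /= -> _]; last first.
  by rewrite tpure0r raddf0.
by rewrite addn1 => -[ein]; rewrite tprojE Dproj_id // -ein.
Qed.

End CentralExtension.

(** * The complex 1M *)

Lemma scaler_comm (R : pzRingType) (V : lmodType R) (a b : R) (v : V) :
  a * b = b * a -> a *: (b *: v) = b *: (a *: v).
Proof. by move=> ab; rewrite !scalerA ab. Qed.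

Section Homology.
Variables (S : nzRingType) (T : csgring S) (P : set T).
Hypothesis Psub : subgrp P.
Variables (K : resolution P) (L : lifting K).
Local Notation D := (D P).
Local Notation etaD := (etaD P).
Local Notation etaA := (etaA P).
Local Notation z := (zD P).
Local Notation d1L := (lift_d1 L).
Local Notation V2 := (res_V K 0).

Lemma lift_d1E x a : d1L (tpure etaD x a) = x * (lift_sigma L a : D).
Proof. exact: tens_recE (lift_d1_balanced L) _ _. Qed.

Lemma lift_d1_additive : exists g : {additive tens etaD (A1 P) -> D}, d1L =1 g.
Proof.
apply: zmod_morphism_additive.
exact: tens_rec_zmod_morphism (lift_d1_balanced L).
Qed.

Lemma lift_d1Z b w : d1L (b *: w) = b * d1L w.
Proof.
have [g gE] := lift_d1_additive; rewrite !gE.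
elim/tens_ind: w => [|x y hx hy|d v]; first by rewrite scaler0 raddf0 mulr0.
  by rewrite scalerBr !raddfB /= hx hy mulrBr.
by rewrite tens_scaleE -!gE !lift_d1E mulrA.
Qed.

Lemma lift_d2Z b w : lift_d2 L (b *: w) = b *: lift_d2 L w.
Proof. exact: linearZZ. Qed.

(* lift_f2 with values in D itself rather than in the regular module D^o. *)
Definition lift_f2D (w : tens etaD V2) : D := lift_f2 L w.

Fact lift_f2D_is_zmod_morphism : zmod_morphism lift_f2D.
Proof. move=> u v; exact: (raddfB (lift_f2 L)). Qed.
HB.instance Definition _ :=
  GRing.isZmodMorphism.Build (tens etaD V2) D lift_f2D
    lift_f2D_is_zmod_morphism.

Lemma lift_f2Z b w : lift_f2D (b *: w) = b * lift_f2D w.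
Proof. exact: (linearZ_LR (lift_f2 L) b w). Qed.

Lemma lift_d1_d2 w : d1L (lift_d2 L w) = - (z * lift_f2D w).
Proof. exact: lift_f2E. Qed.

Lemma delta2E m :
  delta2 L m = (lift_d2 L m.1 - z *: m.2, d1L m.2 + lift_f2D m.1).
Proof. by []. Qed.

Lemma piDA_lift_d1 w : piDA (d1L w) = d1 (piDA_tens w).
Proof.
have [g gE] := lift_d1_additive; have [q qE] := piDA_additive Psub.
have [r rE] := piDA_tens_additive Psub (A1 P).
have [h hE] :=
  zmod_morphism_additive (tens_rec_zmod_morphism (@d1_balanced S T P)).
rewrite gE qE rE [RHS]hE.
elim/tens_ind: w => [|x y hx hy|d v]; first by rewrite !raddf0.
  by rewrite !raddfB /= hx hy.
rewrite -rE piDA_tensE // -hE [RHS]tens_recE; last exact: d1_balanced.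
rewrite -gE -qE lift_d1E (piDA_monoid_morphism Psub).2.
by rewrite lift_sigmaK.
Qed.

Lemma delta1_delta2 m : delta1 L (delta2 L m) = 0.
Proof.
have [g gE] := lift_d1_additive.
rewrite delta2E /delta1 /= gE raddfB -!gE lift_d1_d2 lift_d1Z mulrDr.
by rewrite -opprD [X in _ + X]addrC addNr.
Qed.

Lemma regular_H1_zero : zD_regular P -> H1_zero L.
Proof.
move=> reg; have [g gE] := lift_d1_additive.
have [r rE] := piDA_tens_additive Psub (A1 P).
apply/seteqP; split=> [[x y] xy0|_ [m _ <-]]; last exact: delta1_delta2.
have {}xy0 : d1L x + z * y = 0 by [].
have : ker (@d1 S T P) (piDA_tens x).
  rewrite /ker /= -piDA_lift_d1.
  have [q qE] := piDA_additive Psub.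
  move: (congr1 q xy0); rewrite raddfD raddf0 -!qE.
  by rewrite (piDA_monoid_morphism Psub).2 piDA_zD // mul0r addr0.
rewrite (res_exact1 K) => -[w _ wx].
have [w' w'E] := piDA_tens_surj Psub w.
have /(piDA_tens_ker Psub)[y' y'E] : piDA_tens (lift_d2 L w' - x) = 0.
  by rewrite rE raddfB -!rE lift_d2E w'E wx subrr.
have xE : x = lift_d2 L w' - z *: y' by rewrite -y'E subKr.
exists (w', y') => //; rewrite delta2E /= -xE; congr (_, _).
(* The second coordinates differ by an element killed by z, since both pairs are cycles with the
   same first coordinate. *)
apply/esym/subr0_eq/reg; rewrite mulrBr; move: xy0.
rewrite xE gE raddfB -!gE lift_d1_d2 lift_d1Z => e.
rewrite mulrDr opprD -{}e.
rewrite [RHS]addrC; congr (_ + _); exact: addrC.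
Qed.

(* [X] lifts [w] to D (x) V_2 in such a way that (X, Y) is a cycle of 1M. *)
Definition d3_lift : set (tens etaA V2) :=
  [set w | exists (X : tens etaD V2) (Y : tens etaD (A1 P)),
    [/\ piDA_tens X = w, lift_d2 L X = z *: Y & lift_f2D X = - d1L Y]].

Lemma d3_lift_subgrp : subgrp d3_lift.
Proof.
have [g gE] := lift_d1_additive; have [r rE] := piDA_tens_additive Psub V2.
split=> [|u v [X [Y [h1 h2 h3]]] [X' [Y' [h1' h2' h3']]]].
  exists 0, 0; split; first by rewrite rE raddf0.
    by rewrite raddf0 scaler0.
  by rewrite gE !raddf0.
exists (X - X'), (Y - Y'); split.
- by rewrite rE raddfB -!rE h1 h1'.
- by rewrite raddfB /= h2 h2' scalerBr.
- by rewrite raddfB gE raddfB -!gE /= h3 h3' opprB opprK addrC.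
Qed.

Lemma d3_liftZ a w : d3_lift w -> d3_lift (a *: w).
Proof.
move=> [X [Y [h1 h2 h3]]]; exists (Dlift a *: X), (Dlift a *: Y); split.
- by rewrite (piDA_tensZ Psub) (DliftK Psub) h1.
- by rewrite lift_d2Z h2; apply: scaler_comm; rewrite zD_central.
- by rewrite lift_f2Z h3 lift_d1Z mulrN.
Qed.

(* The obstruction f_2 X + partial_1 Y is killed by z and homogeneous of
   degree m + 1, hence vanishes by the Jacobi condition in that degree. *)
Lemma d3_lift_homog m v : jacobi P m.+1 -> homog (res_gr K 1) m.+2 v ->
  d3_lift (res_d K 0 (tpure etaA 1 v)).
Proof.
move=> J hv; have [g gE] := lift_d1_additive.
have [r rE] := piDA_tens_additive Psub (A1 P).
have h1 : tens_deg (@A_deg S T P) (homog (res_gr K 1)) m.+2 (tpure etaA 1 v).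
  apply: sub_gen_smallest; exists 0%N, m.+2, 1, v; split=> //.
  exists 1; last by rewrite rmorph1.
  by have := homog_unit T 1; rewrite rmorph1.
have [X hX XE] := piDA_tens_lift Psub (res_d_graded h1).
have /(piDA_tens_ker Psub)[y yE] : piDA_tens (lift_d2 L X) = 0.
  rewrite lift_d2E XE.
  have : range (res_d K 0) (res_d K 0 (tpure etaA 1 v)).
    by exists (tpure etaA 1 v).
  by rewrite -res_exact2.
(* As [lift_d2 L X] is homogeneous of degree m + 2, y may be replaced by its component of total
   degree m + 1. *)
have d2X : lift_d2 L X = z *: tproj m y.
  by rewrite -tproj_zD -yE tproj_id //; exact: (lift_d2_graded L hX).
have degY : D_deg m.+1 (d1L (tproj m y)).
  elim/tens_ind: y {yE d2X} => [|u w hu hw|d w].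
  - by rewrite raddf0 gE raddf0; apply: (D_deg_subgrp P _).1.
  - by rewrite raddfB /= gE raddfB -!gE; apply: (D_deg_subgrp P _).2.
  - rewrite tprojE lift_d1E -addn1; apply: D_degM; first exact: Dproj_deg.
    exact: lift_sigma_deg.
exists X, (tproj m y); split=> //; apply/eqP; rewrite -addr_eq0; apply/eqP.
have degX : D_deg m.+1 (lift_f2D X) by exact: (lift_f2_graded L hX).
apply: (jacobi_torsion J); first exact: (subgrpD (D_deg_subgrp P _)).
have e := lift_d1_d2 X; rewrite d2X lift_d1Z in e.
by rewrite mulrDr e addrN.
Qed.

(** By A-linearity only the elements 1 (x) v with v homogeneous matter; those of degree at most 1
    vanish, the others are covered by the Jacobi conditions. *)
Lemma d3_lift_im :
  (forall i, (i <= 1)%N -> homog (res_gr K 1) i = [set 0]) ->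
  (forall m, homog (res_gr K 1) m.+2 <> [set 0] -> jacobi P m.+1) ->
  range (res_d K 0) `<=` d3_lift.
Proof.
move=> K_deg J _ [w _ <-]; have [Q0 QB] := d3_lift_subgrp.
have Qhom i v : homog (res_gr K 1) i v -> d3_lift (res_d K 0 (tpure etaA 1 v)).
  have [->|nz] := EM (homog (res_gr K 1) i = [set 0]).
    by move=> ->; rewrite tpure0r raddf0.
  case: i nz => [|[|m]] nz hv; try by case: nz; rewrite K_deg.
  exact: d3_lift_homog (J m nz) hv.
elim/tens_ind: w => [|u v hu hv|a v]; first by rewrite raddf0.
  by rewrite raddfB; apply: QB.
rewrite -[a]mulr1 -tens_scaleE linearZ; apply: d3_liftZ.
have [N ->] := gproj_sum (res_gr K 1) v; rewrite tpure_sumr raddf_sum.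
apply: (subgrp_sum d3_lift_subgrp) => i _; apply: (Qhom i).
exact: homog_gproj.
Qed.

Lemma H1_zero_regular :
  projective (A1 P) ->
  (forall i, (i <= 1)%N -> homog (res_gr K 1) i = [set 0]) ->
  (forall m, homog (res_gr K 1) m.+2 <> [set 0] -> jacobi P m.+1) ->
  H1_zero L -> zD_regular P.
Proof.
move=> A1_proj K_deg J H1; have [g gE] := lift_d1_additive.
have [r rE] := piDA_tens_additive Psub V2.
have torsion u : z * u = 0 -> exists2 t, z *: t = 0 & u = d1L t.
  move=> zu0; have : ker (delta1 L) (0, u).
    by rewrite /ker /= /delta1 /= gE raddf0 add0r.
  rewrite H1 => -[[x y] _]; rewrite delta2E => -[/subr0_eq d2x uE].
  have : ker (res_d2 K) (piDA_tens x).
    by rewrite /ker /= -(lift_d2E L) d2x piDA_tens_zD.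
  rewrite res_exact2 => /(d3_lift_im K_deg J)[X [Y [XE d2X f2X]]].
  have /(piDA_tens_ker Psub)[x' x'E] : piDA_tens (x - X) = 0.
    by rewrite rE raddfB -!rE XE subrr.
  (* Both (X, Y) and (z x', [lift_d2 L x']) are killed by [delta2]. Subtracting them from (x, y)
     leaves (0, t) with the same image (0, u), so z t = 0 and u is the image of t under
     partial_1. *)
  exists (y - Y - lift_d2 L x').
    have e : lift_d2 L (x - X) = z *: lift_d2 L x' by rewrite x'E lift_d2Z.
    by rewrite !scalerBr -d2x -e raddfB /= d2X subrr.
  rewrite -uE [RHS]gE !raddfB -!gE lift_d1_d2 opprK -addrA; congr (_ + _).
  by rewrite -[x](subrK X) x'E raddfD /= lift_f2Z f2X addrC.
move=> u zu0; apply: Dfil_eq0 => m.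
(* The coordinates of t are again killed by z, so the induction hypothesis applies to them, and the
   factors in D^1 gain one degree. *)
elim: m u zu0 => [|m IH] u zu0; first by move=> n.
have [t zt0 ->] := torsion u zu0.
have [s [c [c0 ->]]] := projective_tens_torsion A1_proj zt0.
rewrite gE raddf_sum; apply: (subgrp_sum (Dfil_subgrp P _)) => k _.
rewrite -gE lift_d1E; apply: DfilM; first by apply: IH; apply: c0.
exact: lift_sigma_deg.
Qed.

End Homology.

(** [supremum] bounds a set from above once a least upper bound is known to exist: here the maximum
    if the degrees are bounded, and infinity otherwise. *)
Lemma ge_complexity (M : zmodType) (G : grading M) n :
  homog G n <> [set 0] -> ((n%:Z - 1)%:E <= complexity G)%E.
Proof.
pose N : set nat := [set m | homog G m <> [set 0]]; move=> Nn.
apply: ge_supremum_Nmem; last by exists n.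
have [[b bN]|unb] := EM (exists b, forall m, N m -> (m <= b)%N).
  have exN : exists m, `[< N m >] by exists n; apply/asboolP.
  have ubN m : `[< N m >] -> (m <= b)%N by move/asboolP; apply: bN.
  have [m /asboolP Nm maxm] := ex_maxnP exN ubN.
  exists (m%:Z - 1)%:E; split=> [_ [k Nk <-]|y]; last by apply; exists m.
  by rewrite lee_fin lerD2r lez_nat; apply: maxm; apply/asboolP.
exists +oo%E; split=> [_ [k Nk <-]|y uby]; first exact: leey.
case: y uby => [y| |] uby.
- exfalso; apply: unb; exists (absz (y + 1 : int)) => m Nm.
  have : ((m%:Z - 1)%:E <= y%:E)%E by apply: uby; exists m.
  rewrite lee_fin lerBlDr -lez_nat => h; apply: le_trans h _.
  by rewrite abszE ler_norm.
- exact: leey.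
- by have : ((n%:Z - 1)%:E <= -oo :> \bar int)%E by apply: uby; exists n.
Qed.

Theorem theorem5p1 (S : nzRingType) (T : csgring S) (P : set T)
    (P_bimod : subbimodule P)
    (P_S : P `&` range (csg_unit T) = [set 0])
    (A1_proj : projective (A1 P))
    (K : resolution P)
    (K_deg : forall n i, (i <= 1)%N -> homog (res_gr K n.+1) i = [set 0])
    (L : lifting K) :
  PBW_type P <->
  H1_zero L /\
  (complexity (res_gr K 1) = (-1)%:E \/
   forall n, (1 <= n)%N ->
     (n%:Z%:E <= complexity (res_gr K 1))%E -> jacobi P n).
Proof.
have [Psub _ _] := P_bimod.
rewrite (PBW_typeP Psub); split=> [J|[H1 J]].
  by split; [apply/regular_H1_zero/zD_regularP | right=> n _ _; apply: J].
apply/zD_regularP/(H1_zero_regular Psub A1_proj (K_deg 0%N)); last exact: H1.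
move=> m /ge_complexity; rewrite -[m.+2]addn1 PoszD addrK.
(* If the complexity is -1, a nonzero part of V_3 in degree m + 2 would give m + 1 <= -1. *)
by case: J => [->|J]; [rewrite lee_fin | apply: J].
Qed.
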